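(* Let $M$ be a complete noncompact Riemannian manifold with the global doubling property, and let $K$ be a compact subset of $M$. Let $f\in W^{1,1}_{loc}(M)$ be a weak solution of $$\operatorname{div}\Big(\frac{\nabla f}{|\nabla f|}\Big)=A(x,f,\nabla f)\quad\text{on }M\setminus K,$$ where $A$ (as a function $x\mapsto A(x,f(x),\nabla f(x))$) is a continuous real-valued function on $M$, or $A$ is either nonnegative valued or nonpositive valued. Put $$w_{K^c}:=\operatorname{ess\,inf}_{x\in M\setminus K}|A(x,f(x),\nabla f(x))| .$$ Then $w_{K^c}=0$.
   Context: $B(x,r)$ is the geodesic ball of radius $r$ centered at $x$, and $dv$ is the Riemannian volume element. Global doubling property: there is a constant $D(M)>0$ such that for all $r>0$ and all $x\in M$, $\mathrm{Vol}(B(x,2r))\le D(M)\,\mathrm{Vol}(B(x,r))$. Weak solution: $f$ is a weak solution of $\operatorname{div}(\nabla f/|\nabla f|)=A(x,f,\nabla f)$ on an open set $\Omega$ if for every $\psi\in C_0^\infty(\Omega)$, $$\int_\Omega\frac{\nabla f}{|\nabla f|}\cdot\nabla\psi\,dv=-\int_\Omega A(x,f(x),\nabla f(x))\,\psi(x)\,dv .$$ Here $\nabla f/|\nabla f|$ is required to make sense almost everywhere; in particular constant functions are not admissible as weak solutions. *)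

(* Defs.v *)
From HB Require Import structures.
From mathcomp Require Import all_boot all_order all_algebra.
From mathcomp Require Import all_classical all_reals all_analysis.

Set Implicit Arguments.
Unset Strict Implicit.
Unset Printing Implicit Defensive.

Import Order.TTheory GRing.Theory Num.Theory.
Import numFieldNormedType.Exports.

Local Open Scope classical_set_scope.
Local Open Scope ring_scope.

Definition compactly_supported_in (T : topologicalType) (V : nmodType)
    (D : set T) (h : T -> V) : Prop :=
  compact (closure [set x | h x != 0]) /\ closure [set x | h x != 0] `<=` D.

Definition partial (R : realType) (n : nat) (W : normedModType R)
    (i : 'I_n) (h : 'rV[R]_n -> W) : 'rV[R]_n -> W :=
  fun u => 'D_(delta_mx 0 i) h u.

(* only meaningful for U open *)
Fixpoint Ck_on (R : realType) (n : nat) (W : normedModType R)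
    (k : nat) (U : set 'rV[R]_n) (h : 'rV[R]_n -> W) : Prop :=
  (forall u, U u -> {for u, continuous h}) /\
  match k with
  | 0%N => True
  | k'.+1 => forall i : 'I_n,
      (forall u, U u -> derivable h u (delta_mx 0 i)) /\
      Ck_on k' U (partial i h)
  end.

Definition smooth_on (R : realType) (n : nat) (W : normedModType R)
    (U : set 'rV[R]_n) (h : 'rV[R]_n -> W) : Prop :=
  forall k, Ck_on k U h.

Definition borel (T : ptopologicalType) := g_sigma_algebraType (@open T).

(* Determines [leb] uniquely among the Borel measures. *)
Definition is_lebesgue (R : realType) (n : nat)
    (leb : {measure set (borel 'rV[R]_n) -> \bar R}) : Prop :=
  forall a b : 'rV[R]_n, (forall i, a 0 i <= b 0 i) ->
    leb [set u : 'rV[R]_n | forall i, a 0 i <= u 0 i <= b 0 i]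
      = (\prod_(i < n) (b 0 i - a 0 i))%:E.

Definition L1loc_on (R : realType) (n : nat)
    (leb : {measure set (borel 'rV[R]_n) -> \bar R})
    (U : set 'rV[R]_n) (h : 'rV[R]_n -> R) : Prop :=
  forall C : set 'rV[R]_n, compact C -> C `<=` U ->
    leb.-integrable (C : set (borel 'rV[R]_n)) (EFin \o h).

Definition weak_partial_on (R : realType) (n : nat)
    (leb : {measure set (borel 'rV[R]_n) -> \bar R})
    (U : set 'rV[R]_n) (i : 'I_n) (h dh : 'rV[R]_n -> R) : Prop :=
  forall eta : 'rV[R]_n -> R, smooth_on setT eta ->
    compactly_supported_in U eta ->
    (\int[leb]_(u in U) (h u * partial i eta u)%:E
      = - \int[leb]_(u in U) (dh u * eta u)%:E)%E.

(* A chart is a homeomorphism between open sets, extended by junk values to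
   total functions. [chart_at] chooses one chart around each point, whose
   coordinates then represent the tangent vectors at that point. *)
Record smooth_manifold (R : realType) (n : nat) (M : topologicalType) :=
  SmoothManifold {
  chart : Type;
  chart_dom : chart -> set M;
  chart_map : chart -> M -> 'rV[R]_n;
  chart_inv : chart -> 'rV[R]_n -> M;
  chart_at : M -> chart;
  manifold_hausdorff : hausdorff_space M;
  manifold_second_countable : @second_countable M;
  chart_dom_open : forall c, open (chart_dom c);
  chart_cod_open : forall c, open (chart_map c @` chart_dom c);
  chart_mapK : forall c x, chart_dom c x -> chart_inv c (chart_map c x) = x;
  chart_map_continuous : forall c x, chart_dom c x ->
    {for x, continuous (chart_map c)};
  chart_inv_continuous : forall c u, (chart_map c @` chart_dom c) u ->
    {for u, continuous (chart_inv c)};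
  chart_at_dom : forall x, chart_dom (chart_at x) x;
  transition_smooth : forall c c',
    smooth_on (chart_map c @` (chart_dom c `&` chart_dom c'))
              (chart_map c' \o chart_inv c)
}.

(* T_x M, by coordinates with respect to [chart_at X x] *)
Definition tangent (R : realType) (n : nat) (M : topologicalType)
    (X : smooth_manifold R n M) (x : M) : Type := 'rV[R]_n.

Section Manifold.
Context (R : realType) (n : nat) (M : topologicalType).
Variable X : smooth_manifold R n M.

Definition chart_cod (c : chart X) : set 'rV[R]_n :=
  chart_map c @` chart_dom c.

(* Acts on the right of row vectors, from [c]- to [c']-coordinates. *)
Definition transition_jacobian (c c' : chart X) (x : M) : 'M[R]_n :=
  jacobian (chart_map c' \o chart_inv c) (chart_map c x).

Definition in_chart (c : chart X) (x : M) (v : tangent X x) : 'rV[R]_n :=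
  v *m transition_jacobian (chart_at X x) c x.

Definition smooth_function (psi : M -> R) : Prop :=
  forall c : chart X,
    smooth_on (chart_cod c) (psi \o chart_inv c : 'rV[R]_n -> R^o).

Definition test_function (Omega : set M) (psi : M -> R) : Prop :=
  smooth_function psi /\ compactly_supported_in Omega psi.

End Manifold.

(* [gram c u] is the matrix (g_ij) in the chart [c] at the coordinates [u]. *)
Record riemannian_metric (R : realType) (n : nat) (M : topologicalType)
    (X : smooth_manifold R n M) := RiemannianMetric {
  gram : chart X -> 'rV[R]_n -> 'M[R]_n;
  gram_smooth : forall c i j,
    smooth_on (chart_cod c) (fun u => gram c u i j : R^o);
  gram_sym : forall c u, chart_cod c u -> (gram c u)^T = gram c u;
  gram_posdef : forall c u, chart_cod c u -> forall v : 'rV[R]_n, v != 0 ->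
    0 < (v *m gram c u *m v^T) 0 0;
  gram_transition : forall c c' x, chart_dom c x -> chart_dom c' x ->
    gram c (chart_map c x)
      = transition_jacobian c c' x *m gram c' (chart_map c' x)
        *m (transition_jacobian c c' x)^T
}.

Section Riemannian.
Context (R : realType) (n : nat) (M : topologicalType).
Context (X : smooth_manifold R n M).
Variable g : riemannian_metric X.

Definition gram_at (x : M) : 'M[R]_n :=
  gram g (chart_at X x) (chart_map (chart_at X x) x).

Definition inner (x : M) (v w : tangent X x) : R :=
  (v *m gram_at x *m w^T) 0 0.

Definition tnorm (x : M) (v : tangent X x) : R := Num.sqrt (inner v v).

(* g^ij d_j psi *)
Definition grad (psi : M -> R) (x : M) : tangent X x :=
  (\row_i partial i (psi \o chart_inv (chart_at X x) : 'rV[R]_n -> R^o)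
            (chart_map (chart_at X x) x))
    *m invmx (gram_at x).

Definition C1_curve (gamma : R -> M) : Prop :=
  forall t : R, 0 <= t <= 1 ->
    {for t, continuous gamma} /\
    forall c : chart X, chart_dom c (gamma t) ->
      (\forall s \near t, derivable (chart_map c \o gamma) s 1) /\
      {for t, continuous (fun s => 'D_1 (chart_map c \o gamma) s)}.

Definition velocity (gamma : R -> M) (t : R) : tangent X (gamma t) :=
  'D_1 (chart_map (chart_at X (gamma t)) \o gamma) t.

Definition curve_length (gamma : R -> M) : \bar R :=
  (\int[lebesgue_measure]_(t in `[0%R, 1%R]) (tnorm (velocity gamma t))%:E)%E.

(* A piecewise C^1 curve is a chain of C^1 curves parametrized by [0, 1]. *)
Inductive piecewise_C1_path : M -> M -> \bar R -> Prop :=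
| path_nil x : piecewise_C1_path x x 0%E
| path_cons (gamma : R -> M) y l : C1_curve gamma ->
    piecewise_C1_path (gamma 1) y l ->
    piecewise_C1_path (gamma 0) y (curve_length gamma + l)%E.

(* [+oo] between points in different connected components *)
Definition geodesic_dist (x y : M) : \bar R :=
  ereal_inf [set l | piecewise_C1_path x y l].

Definition geodesic_ball (x : M) (r : R) : set M :=
  [set y | (geodesic_dist x y < r%:E)%E].

Definition complete_manifold : Prop :=
  forall u : nat -> M,
    (forall e : R, 0 < e -> exists N, forall p q, (N <= p)%N -> (N <= q)%N ->
       (geodesic_dist (u p) (u q) < e%:E)%E) ->
    exists x, forall e : R, 0 < e -> exists N, forall p, (N <= p)%N ->
      (geodesic_dist (u p) x < e%:E)%E.

End Riemannian.

Section Analysis.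
Context (R : realType) (n : nat) (M : ptopologicalType).
Context (X : smooth_manifold R n M).
Variable g : riemannian_metric X.
Variable leb : {measure set (borel 'rV[R]_n) -> \bar R}.
Variable vol : {measure set (borel M) -> \bar R}.

(* dv = sqrt (det g_ij) dx^1 ... dx^n in every chart; this determines [vol]
   uniquely, since countably many charts cover M. *)
Definition is_riemannian_volume : Prop :=
  forall (c : chart X) (E : set (borel M)), measurable E ->
    E `<=` chart_dom c ->
    vol E = (\int[leb]_(u in chart_map c @` E)
               (Num.sqrt (\det (gram g c u)))%:E)%E.

Definition global_doubling : Prop :=
  exists D : R, 0 < D /\ forall (r : R) (x : M), 0 < r ->
    (vol (geodesic_ball g x (2 * r)) <= D%:E * vol (geodesic_ball g x r))%E.

(* f belongs to W^{1,1}_loc(M) and [df] is its weak gradient: in every chart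
   the weak partial derivatives of f are the covariant components
   g_ij (nabla f)^j. *)
Definition W11loc_with_gradient (f : M -> R)
    (df : forall x : M, tangent X x) : Prop :=
  forall c : chart X,
    L1loc_on leb (chart_cod c) (f \o chart_inv c) /\
    forall i : 'I_n,
      let dfi := fun u =>
        (in_chart c (df (chart_inv c u)) *m gram g c u) 0 i in
      L1loc_on leb (chart_cod c) dfi /\
      weak_partial_on leb (chart_cod c) i (f \o chart_inv c) dfi.

(* div (df / |df|) = A(x, f, df) weakly on Omega *)
Definition weak_solution (Omega : set M)
    (A : forall x : M, R -> tangent X x -> R)
    (f : M -> R) (df : forall x : M, tangent X x) : Prop :=
  {ae vol, forall x : M, Omega x -> df x != 0 :> 'rV[R]_n} /\
  forall psi : M -> R, test_function X Omega psi ->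
    vol.-integrable (Omega : set (borel M))
      (fun x => (A x (f x) (df x) * psi x)%:E) /\
    (\int[vol]_(x in Omega)
        (inner g (((tnorm g (df x))^-1 *: (df x : 'rV[R]_n)) : tangent X x)
                 (grad g psi x))%:E
      = - \int[vol]_(x in Omega) (A x (f x) (df x) * psi x)%:E)%E.

Definition ess_inf_on (D : set M) (h : M -> \bar R) : \bar R :=
  ereal_sup [set y | {ae vol, forall x : M, D x -> (y <= h x)%E}].

End Analysis.

(* Main.v *)
From HB Require Import structures.
Require Import Defs.
From mathcomp Require Import all_boot all_order all_algebra finmap.
From mathcomp Require Import all_classical all_reals all_analysis.
From mathcomp Require Import measurable_realfun ring lra.

Set Implicit Arguments.
Unset Strict Implicit.
Unset Printing Implicit Defensive.

Import Order.TTheory GRing.Theory Num.Theory.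
Import numFieldNormedType.Exports.

Local Open Scope classical_set_scope.
Local Open Scope ring_scope.

(** Let V = df / |df|. Since |V| <= 1, the weak form of the equation gives
    | int A psi | <= int |grad psi| for every test function psi. Suppose |A| >= w > 0 almost
    everywhere off [K], and let [sigma] be the sign of A. It is constant when A
    is nonnegative or nonpositive, and it is locally constant off [K] when A is
    continuous, since then |A| >= w holds everywhere there
    ([sgr_locally_constant]). So [sigma * psi] is again a test function, and
    w * int psi <= int |grad psi| for every nonnegative test function psi
    supported off [K]. If a ball B(x, 2r) avoids [K], take for psi a smooth
    cutoff that is 1 on B(x, r), vanishes off B(x, 2r) and has gradient at most
    C / r. With the doubling property this gives
    w Vol B(x, r) <= (C / r) Vol B(x, 2r) <= (C D / r) Vol B(x, r),
    hence w <= C D / r, and r is arbitrary ([radius_bound]).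

    Two ingredients need work.

    Balls of any radius avoiding [K] exist because closed bounded sets are
    compact. The doubling property leads there faster than the theorem of Hopf and
    Rinow: separated points in a ball are bounded in number ([packing]), so balls
    are totally bounded, and completeness makes them precompact
    ([bounded_ultrafilter_cvg]). If every ball of radius 2r met the compact set
    [K], then finitely many balls would cover M, and M would be compact
    ([exists_ball_away]).

    Smooth cutoffs with controlled gradient are built without mollifying the
    distance. At a scale e so small that every chart in sight distorts lengths by
    at most a factor 2, take a maximal e-separated net of B(x, 2r), put a bump of
    size e at each point of the net, and compose the sum of the bumps centered in
    B(x, a) with a smooth step ([exists_cutoff]). The result is 1 inside, 0
    outside, and its gradient is supported in a collar of width 13 e around the
    sphere of radius a and is at most C / e there, where C depends only on the doubling constant because
    packing bounds the number of bumps alive at a point. The equation tested with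
    this function gives w Vol B(x, r) <= (C / e) Vol(collar)
    ([collar_estimate]). The annulus B(x, 2r) - B(x, r) is cut into r / (13 e)
    such collars, so summing these estimates turns 1 / e into 13 / r.

    Gradients are controlled through Lipschitz bounds along straight segments
    in charts ([lipschitz_inner_grad]). The distance is compared with a chart by
    [ball_chart_line] (segments have nearly their Euclidean length) and
    [ball_stays] (a short curve cannot leave a chart). *)

(** * Differentiability from continuous partial derivatives *)

Lemma near_eq_continuous_at (T U : topologicalType) (f g : T -> U) (x : T) :
  (\near x, f x = g x) -> {for x, continuous f} -> {for x, continuous g}.
Proof.
move=> fg; rewrite /prop_for /continuous_at => fc.
rewrite -(nbhs_singleton fg : f x = g x).
by apply: cvg_trans fc; apply: near_eq_cvg; apply: filterS fg => y ->.
Qed.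

Lemma is_derive_line (R : numFieldType) (V W : normedModType R) (f : V -> W)
    (p v : V) (t : R) : derivable f (p + t *: v) v ->
  is_derive t 1 (fun s : R => f (p + s *: v)) ('D_v f (p + t *: v)).
Proof.
move=> fD; have E : (fun h : R => h^-1 *:
      (((fun s : R => f (p + s *: v)) \o shift t) h%:A - f (p + t *: v))) =
    (fun h : R => h^-1 *: ((f \o shift (p + t *: v)) (h *: v) - f (p + t *: v))).
  by apply/funext => h /=; rewrite scalerDl addrCA [h%:A]mulr1.
by split; rewrite /derivable /derive E.
Qed.

Lemma ler_rVnorm (R : realType) n (v : 'rV[R]_n) (b : R) : 0 <= b ->
  (forall j, `|v 0 j| <= b) -> `|v| <= b.
Proof.
move=> b0 H; rewrite /Num.Def.normr/= mx_normrE; apply: bigmax_le => //.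
by move=> [i j] _ /=; rewrite ord1.
Qed.

Lemma ler_coord_norm (R : realType) n (v : 'rV[R]_n) j : `|v 0 j| <= `|v|.
Proof.
rewrite [leRHS]/Num.Def.normr/= mx_normrE.
exact: (le_bigmax _ (fun ij : 'I_1 * 'I_n => `|v ij.1 ij.2|) (0, j)).
Qed.

Lemma continuous_at_sum (R : numFieldType) (T : topologicalType)
    (W : normedModType R) (I : Type) (r : seq I) (F : I -> T -> W) (x : T) :
  (forall i, {for x, continuous (F i)}) ->
  {for x, continuous (fun y => \sum_(i <- r) F i y)}.
Proof.
move=> Fc; elim: r => [|i r IHr]; rewrite /prop_for /continuous_at.
  by under eq_cvg do rewrite big_nil; rewrite big_nil; exact: cvg_cst.
by under eq_cvg do rewrite big_cons; rewrite big_cons; apply: cvgD; [exact: Fc|].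
Qed.

Section C1Differentiable.
Context (R : realType) (n : nat).

Lemma MVT_from0 (g dg : R -> R) (b : R) :
  (forall t : R, `|t| <= `|b| -> is_derive t 1 g (dg t)) ->
  exists2 c, `|c| <= `|b| & g b - g 0 = dg c * b.
Proof.
move=> gD; have gc t : `|t| <= `|b| -> {for t, continuous g}.
  move=> tb; apply/differentiable_continuous/derivable1_diffP.
  by case: (gD t tb).
case: (ltgtP b 0) => [b0|b0|->].
- have H t : t \in `[b, 0] -> `|t| <= `|b|.
    by rewrite in_itv/= => /andP[bt t0]; rewrite !ler0_norm ?lerN2// ltW.
  have [||c cb E] := @MVT R g dg b 0 b0.
  + move=> x xb; apply/gD/H; exact: subset_itv_oo_cc.
  + apply: continuous_in_subspaceT => x; rewrite inE => xb.
    by apply: gc; apply: H.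
  exists c; first by apply: H; apply: subset_itv_oo_cc.
  by rewrite -opprB E sub0r mulrN opprK.
- have H t : t \in `[0, b] -> `|t| <= `|b|.
    by rewrite in_itv/= => /andP[bt t0]; rewrite !ger0_norm// ltW.
  have [||c cb E] := @MVT R g dg 0 b b0.
  + move=> x xb; apply/gD/H; exact: subset_itv_oo_cc.
  + apply: continuous_in_subspaceT => x; rewrite inE => xb.
    by apply: gc; apply: H.
  exists c; first by apply: H; apply: subset_itv_oo_cc.
  by rewrite E subr0.
- by exists 0 => //; rewrite subrr mulr0.
Qed.

(** The vertices of the broken line from 0 to [h] that follows the coordinate
    axes in turn; consecutive vertices differ by one coordinate. *)
Definition trunc_row (k : nat) (h : 'rV[R]_n) : 'rV[R]_n :=
  \row_j (if (j < k)%N then h 0 j else 0).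

(** The mean value theorem on each edge of the broken line from [u] to [u + h]
    evaluates a partial derivative at a point within [`|h|] of [u], where it is
    close to its value at [u]. *)
Lemma scalar_increment_estimate (f : 'rV[R]_n -> R^o) (u : 'rV[R]_n) :
  (forall i : 'I_n, \forall x \near u, derivable f x (delta_mx 0 i)) ->
  (forall i : 'I_n, {for u, continuous (partial i f)}) ->
  forall e : R, 0 < e -> \forall h \near (0 : 'rV[R]_n),
    `|f (u + h) - f u - \sum_i h 0 i *: partial i f u| <= e * `|h|.
Proof.
move=> fD fc e e0.
(* [n.+1] rather than [n], so that dimension 0 needs no separate case. *)
have e'0 : 0 < e / n.+1%:R by rewrite divr_gt0// ltr0n.
have : \forall x \near u, forall i : 'I_n,
    derivable f x (delta_mx 0 i) /\ `|partial i f u - partial i f x| <= e / n.+1%:R.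
  apply: (@filter_forall _ _ (fun (i : 'I_n) x => derivable f x (delta_mx 0 i) /\
    `|partial i f u - partial i f x| <= e / n.+1%:R) _ (nbhs_filter u)) => i.
  apply: filterI; first exact: fD.
  by move/cvgrPdist_le : (fc i) => /(_ _ e'0).
move=> /nbhs_ballP[r /= r0 Hr].
near=> h.
have hr : `|h| < r.
  near: h; apply: filterS (nbhsx_ballx (0 : 'rV[R]_n) r r0) => x.
  by rewrite -ball_normE /= sub0r normrN.
have step (k : 'I_n) : exists2 d,
    `|partial k f u - d| <= e / n.+1%:R &
    f (u + trunc_row k.+1 h) - f (u + trunc_row k h) = d * h 0 k.
  have E : trunc_row k.+1 h = trunc_row k h + h 0 k *: delta_mx 0 k.
    apply/rowP => j; rewrite !mxE eqxx/= ltnS leq_eqVlt.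
    have [->|jk] := eqVneq j k; first by rewrite eqxx ltnn mulr1 add0r.
    by rewrite -[(_ == _ :> nat)]/(j == k) (negbTE jk) mulr0 addr0.
  pose g (t : R) := f (u + trunc_row k h + t *: delta_mx 0 k).
  have B t : `|t| <= `|h 0 k| -> ball u r (u + trunc_row k h + t *: delta_mx 0 k).
    move=> tk; rewrite -ball_normE /= -addrA opprD addrA subrr sub0r normrN.
    apply: le_lt_trans hr; apply: ler_rVnorm => // j; rewrite !mxE eqxx/=.
    case: ifPn => jk; last first.
      rewrite add0r; have [_|_] := eqVneq j k; rewrite ?mulr1 ?mulr0 ?normr0//.
      by apply: (le_trans tk); exact: ler_coord_norm.
    rewrite (_ : (j == k) = false) ?mulr0 ?addr0; first exact: ler_coord_norm.
    by apply/negbTE/eqP => jk'; rewrite jk' ltnn in jk.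
  have [|c cb gE] := @MVT_from0 g (fun t => partial k f (u + trunc_row k h + t *: delta_mx 0 k)) (h 0 k).
    move=> t tb; set p := u + trunc_row k h.
    have dp := (Hr _ (B t tb) k).1.
    exact: is_derive_line.
  exists (partial k f (u + trunc_row k h + c *: delta_mx 0 k)).
    exact: (Hr _ (B c cb) k).2.
  by rewrite E addrA -gE /g scale0r addr0.
have -> : f (u + h) - f u = \sum_(k < n)
    (f (u + trunc_row k.+1 h) - f (u + trunc_row k h)).
  rewrite -(big_mkord xpredT (fun k => f (u + trunc_row k.+1 h) - f (u + trunc_row k h))).
  rewrite telescope_sumr//; congr (f _ - f _).
    by congr (_ + _); apply/rowP => j; rewrite mxE ltn_ord.
  by rewrite (_ : trunc_row 0 h = 0) ?addr0//; apply/rowP => j; rewrite !mxE ltn0.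
rewrite -sumrB; apply: le_trans (ler_norm_sum _ _ _) _.
apply: (@le_trans _ _ (\sum_(k < n) e / n.+1%:R * `|h|)).
  apply: ler_sum => k _; have [d dk ->] := step k.
  rewrite [_ *: _]mulrC -mulrBl normrM distrC ler_pM//; exact: ler_coord_norm.
rewrite sumr_const card_ord -mulrnAl ler_wpM2r// -mulr_natr -mulrA.
by apply: ler_piMr; [exact: ltW|]; rewrite ler_pdivrMl ?ltr0n// mulr1 ler_nat leqnSn.
Unshelve. all: by end_near. Qed.

Lemma increment_estimate_differentiable (W : normedModType R)
    (f : 'rV[R]_n -> W) (u : 'rV[R]_n) (a : 'I_n -> W) :
  (forall e : R, 0 < e -> \forall h \near (0 : 'rV[R]_n),
    `|f (u + h) - f u - \sum_i h 0 i *: a i| <= e * `|h|) ->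
  differentiable f u.
Proof.
move=> fE; pose L (h : 'rV[R]_n) : W := \sum_i h 0 i *: a i.
have Llin : linear L.
  move=> k x y; rewrite /L scaler_sumr -big_split; apply: eq_bigr => i _ /=.
  by rewrite !mxE scalerDl scalerA.
pose LM := GRing.isLinear.Build _ _ _ _ _ Llin.
pose LL : {linear 'rV[R]_n -> W} := HB.pack L LM.
have Lc : continuous LL.
  move=> x; apply: (@continuous_at_sum _ _ _ _ _ (fun i (h : 'rV[R]_n) => h 0 i *: a i)) => i.
  by exact: cvgZr_tmp (@coord_continuous _ _ _ 0 i x).
have fL (e : {posnum R}) : \forall h \near (0 : 'rV[R]_n),
    `|f (h + u) - (f u + LL h)| <= e%:num * `|h|.
  by apply: filterS (fE e%:num _) => // h; rewrite [h + u]addrC opprD addrA.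
have dE : 'd f u = LL :> (_ -> _).
  by apply: diff_unique => //; apply/eqaddoP => _/posnumP[e]; exact: fL.
apply/diff_locallyP; rewrite dE; split=> //.
by apply/eqaddoP => _/posnumP[e]; exact: fL.
Qed.

Lemma derive_sum_partial (W : normedModType R) (f : 'rV[R]_n -> W)
    (u v : 'rV[R]_n) : differentiable f u ->
  'D_v f u = \sum_i v 0 i *: partial i f u.
Proof.
move=> fD; rewrite deriveE// {1}(row_sum_delta v) linear_sum.
by apply: eq_bigr => i _; rewrite linearZ /partial deriveE.
Qed.

Lemma C1_differentiable (U : set 'rV[R]_n) (f : 'rV[R]_n -> R^o) :
  open U -> Ck_on 1 U f -> forall u, U u -> differentiable f u.
Proof.
move=> oU [_ fD] u Uu.
apply: (@increment_estimate_differentiable _ f u (fun i => partial i f u)).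
apply: scalar_increment_estimate => i; last by have [_ [+ _]] := fD i; exact.
have := open_nbhs_nbhs (conj oU Uu).
by apply: filterS => x Ux; have [+ _] := fD i; exact.
Qed.

(** The increment estimate holds coordinate by coordinate, hence for the
    supremum norm. *)
Lemma C1_differentiable_row m (U : set 'rV[R]_n) (f : 'rV[R]_n -> 'rV[R]_m) :
  open U -> Ck_on 1 U f -> forall u, U u -> differentiable f u.
Proof.
move=> oU [_ fD] u Uu.
have fDx i x : U x -> derivable f x (delta_mx 0 i).
  by have [+ _] := fD i; exact.
have partialE i x j : U x ->
    partial i (fun y => f y 0 j : R^o) x = partial i f x 0 j.
  by move=> Ux; rewrite /partial derive_mx ?mxE//; exact: fDx.
apply: (@increment_estimate_differentiable _ f u (fun i => partial i f u)).
move=> e e0.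
have : \forall h \near (0 : 'rV[R]_n), forall j : 'I_m,
    `|f (u + h) 0 j - f u 0 j - \sum_i h 0 i *: partial i (fun y => f y 0 j : R^o) u|
      <= e * `|h|.
  apply: (@filter_forall _ _ (fun (j : 'I_m) (h : 'rV[R]_n) =>
    `|f (u + h) 0 j - f u 0 j - \sum_i h 0 i *: partial i (fun y => f y 0 j : R^o) u|
      <= e * `|h|) _ (nbhs_filter (0 : 'rV[R]_n))) => j.
  have UU := open_nbhs_nbhs (conj oU Uu).
  apply: (@scalar_increment_estimate (fun y => f y 0 j)) => // i.
    by apply: filterS UU => x Ux; have /derivable_mxP/(_ 0 j) := fDx i x Ux.
  have [_ [/(_ u Uu) pc _]] := fD i.
  have pcj : {for u, continuous (fun x => partial i f x 0 j)}.
    exact: (continuous_comp pc (@coord_continuous _ _ _ 0 j _)).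
  apply: (near_eq_continuous_at _ pcj).
  by apply: filterS UU => x Ux; rewrite partialE.
apply: filterS => h H; apply: ler_rVnorm => [|j]; first by rewrite mulr_ge0// ltW.
have := H j; rewrite !mxE summxE; congr (`|_ - _| <= _).
by apply: eq_bigr => i _; rewrite partialE// !mxE.
Qed.

End C1Differentiable.

(** * Functions of class C^k *)

Section CkCalculus.
Context (R : realType) (n : nat).
Implicit Types (W : normedModType R) (U V : set 'rV[R]_n).

Lemma Ck_on_continuous W k U (h : 'rV[R]_n -> W) u :
  Ck_on k U h -> U u -> {for u, continuous h}.
Proof. by case: k => [|k] [hc _]; exact: hc. Qed.

(** Being of class C^k is a local property: this is what allows functions on the
    manifold to be glued from chart expressions and constants. *)
Lemma Ck_on_local W k U (h : 'rV[R]_n -> W) : open U ->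
  (forall u, U u -> exists V (h' : 'rV[R]_n -> W),
     [/\ open V, V u, Ck_on k V h' & forall x, V x -> h' x = h x]) ->
  Ck_on k U h.
Proof.
move=> oU; elim: k h => [|k IHk] h loc.
  split=> // u /loc[V [h' [oV Vu [h'c _] h'h]]].
  by apply: near_eq_continuous_at (h'c _ Vu); apply: filterS (open_nbhs_nbhs (conj oV Vu)).
have near_h V h' u : open V -> V u -> (forall x, V x -> h' x = h x) ->
    \near u, h' u = h u.
  by move=> oV Vu h'h; apply: filterS (open_nbhs_nbhs (conj oV Vu)).
split=> [u /loc[V [h' [oV Vu h'C h'h]]]|i].
  exact: near_eq_continuous_at (near_h _ _ _ oV Vu h'h) (Ck_on_continuous h'C Vu).
split=> [u /loc[V [h' [oV Vu [_ h'D] h'h]]]|].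
  by apply: near_eq_derivable (near_h _ _ _ oV Vu h'h) _; have [+ _] := h'D i; exact.
apply: IHk => u /loc[V [h' [oV Vu [_ h'D] h'h]]].
exists V, (partial i h'); split=> //; first by have [] := h'D i.
by move=> x Vx; apply: near_eq_derive; exact: near_h oV Vx h'h.
Qed.

Lemma eq_Ck_on W k U (h h' : 'rV[R]_n -> W) : open U ->
  (forall x, U x -> h x = h' x) -> Ck_on k U h -> Ck_on k U h'.
Proof. by move=> oU hh' hC; apply: Ck_on_local => // u Uu; exists U, h. Qed.

Lemma Ck_on_sub W k U V (h : 'rV[R]_n -> W) :
  U `<=` V -> Ck_on k V h -> Ck_on k U h.
Proof.
elim: k h => [|k IHk] h UV [hc hD]; split=> //.
- by move=> u /UV; exact: hc.
- by move=> u /UV; exact: hc.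
- move=> i; have [hDi hCi] := hD i.
  by split=> [u /UV|]; [exact: hDi|exact: IHk].
Qed.

Lemma Ck_onW W k U (h : 'rV[R]_n -> W) : Ck_on k.+1 U h -> Ck_on k U h.
Proof.
elim: k h => [|k IHk] h; first by case.
move=> [hc hD]; split=> // i; have [hDi hCi] := hD i.
by split=> //; exact: IHk.
Qed.

Lemma Ck_on_cst W k U (w : W) : Ck_on k U (cst w : 'rV[R]_n -> W).
Proof.
elim: k w => [|k IHk] w; split=> //.
- by move=> u _; exact: cst_continuous.
- by move=> u _; exact: cst_continuous.
- move=> i; split; first by move=> u _; exact: derivable_cst.
  rewrite (_ : partial i _ = cst 0); first exact: IHk.
  by apply/funext => x; rewrite /partial derive_cst.
Qed.

Lemma Ck_onD W k U (h1 h2 : 'rV[R]_n -> W) : open U ->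
  Ck_on k U h1 -> Ck_on k U h2 -> Ck_on k U (fun x => h1 x + h2 x).
Proof.
move=> oU; elim: k h1 h2 => [|k IHk] h1 h2 [c1 D1] [c2 D2]; split=> //.
- by move=> u Uu; exact: cvgD (c1 u Uu) (c2 u Uu).
- by move=> u Uu; exact: cvgD (c1 u Uu) (c2 u Uu).
- move=> i; have [D1i C1i] := D1 i; have [D2i C2i] := D2 i.
  split=> [u Uu|]; first by apply: derivableD; [exact: D1i|exact: D2i].
  apply: eq_Ck_on (IHk _ _ C1i C2i) => // x Ux.
  by rewrite /partial -deriveD; [|exact: D1i|exact: D2i].
Qed.

Lemma Ck_onM k U (h1 h2 : 'rV[R]_n -> R^o) : open U ->
  Ck_on k U h1 -> Ck_on k U h2 -> Ck_on k U (fun x => h1 x * h2 x : R^o).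
Proof.
move=> oU; elim: k h1 h2 => [|k IHk] h1 h2 C1 C2.
  by split=> // u Uu; exact: cvgM (Ck_on_continuous C1 Uu) (Ck_on_continuous C2 Uu).
split=> [u Uu|i].
  by exact: cvgM (Ck_on_continuous C1 Uu) (Ck_on_continuous C2 Uu).
have [D1i C1i] := C1.2 i; have [D2i C2i] := C2.2 i.
split=> [u Uu|]; first by apply: derivableM; [exact: D1i|exact: D2i].
apply: (@eq_Ck_on _ _ _ (fun x => h1 x * partial i h2 x + h2 x * partial i h1 x)) => //.
  by move=> x Ux; rewrite /partial deriveM; [|exact: D1i|exact: D2i].
by apply: Ck_onD => //; apply: IHk => //; exact: Ck_onW.
Qed.

Lemma Ck_on_sum W (I : Type) (r : seq I) k U (h : I -> 'rV[R]_n -> W) : open U ->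
  (forall i, Ck_on k U (h i)) -> Ck_on k U (fun x => \sum_(i <- r) h i x).
Proof.
move=> oU hC; elim: r => [|i r IHr].
  by apply: eq_Ck_on (Ck_on_cst k U 0) => // x _; rewrite big_nil.
by apply: eq_Ck_on (Ck_onD oU (hC i) IHr) => // x _; rewrite big_cons.
Qed.

Lemma Ck_on_coord m k U (h : 'rV[R]_n -> 'rV[R]_m) j : open U ->
  Ck_on k U h -> Ck_on k U (fun x => h x 0 j : R^o).
Proof.
move=> oU; elim: k h => [|k IHk] h hC.
  split=> // u Uu; have hc := Ck_on_continuous hC Uu.
  exact: (continuous_comp hc (@coord_continuous _ _ _ 0 j _)).
split=> [u Uu|i].
  have hc := Ck_on_continuous hC Uu.
  exact: (continuous_comp hc (@coord_continuous _ _ _ 0 j _)).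
have [hD hCi] := hC.2 i; split=> [u Uu|].
  by have /derivable_mxP/(_ 0 j) := hD u Uu.
apply: eq_Ck_on (IHk _ hCi) => // x Ux.
by rewrite /partial derive_mx ?mxE//; exact: hD.
Qed.

(** A primitive form of smoothness on the line: it only asks for a chain of
    derivatives, so that closure under composition on the left of a C^k function
    follows by induction from the product rule. *)
Fixpoint derivable_k (k : nat) (theta : R -> R) : Prop :=
  match k with
  | 0%N => continuous theta
  | k'.+1 => exists2 theta' : R -> R,
      (forall t : R, is_derive t 1 theta (theta' t)) & derivable_k k' theta'
  end.

Lemma derivable_k_continuous k theta : derivable_k k theta -> continuous theta.
Proof.
case: k => [//|k] [theta' thetaD _] t.
by apply/differentiable_continuous/derivable1_diffP; case: (thetaD t).
Qed.

(** Restriction to the line through [u] directed by [v] reduces this chain rule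
    to functions of one variable. *)
Lemma is_derive_comp (theta : R -> R) (h : 'rV[R]_n -> R^o) (u v : 'rV[R]_n)
    (dtheta : R) : derivable h u v -> is_derive (h u : R) 1 theta dtheta ->
  is_derive u v (theta \o h : 'rV[R]_n -> R^o) (dtheta * 'D_v h u).
Proof.
move=> hD thetaD; pose l (t : R) := h (u + t *: v).
have lD : is_derive (0 : R) 1 l ('D_v h u).
  by have := @is_derive_line _ _ _ h u v 0; rewrite scale0r addr0; exact.
have thetaD' : is_derive (l 0 : R) 1 theta dtheta by rewrite /l scale0r addr0.
have thlD := is_derive1_comp thetaD' lD.
have E : (fun t : R => t^-1 *: ((theta \o h \o shift u) (t *: v) - (theta \o h) u)) =
    (fun t : R => t^-1 *: ((theta \o l \o shift 0) t%:A - (theta \o l) 0)).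
  by apply/funext => t; rewrite /l /= addr0 scale0r addr0 [t%:A]mulr1 [u + _]addrC.
by split; rewrite /derivable /derive E; [case: thlD|exact: (@derive_val _ _ _ _ _ _ _ thlD)].
Qed.

Lemma Ck_on_comp k U (theta : R -> R) (h : 'rV[R]_n -> R^o) : open U ->
  derivable_k k theta -> Ck_on k U h ->
  Ck_on k U (theta \o h : 'rV[R]_n -> R^o).
Proof.
move=> oU; elim: k theta h => [|k IHk] theta h thetaC hC.
  split=> // u Uu; apply: continuous_comp; last exact: thetaC.
  exact: (Ck_on_continuous hC Uu).
have [theta' thetaD thetaC'] := thetaC.
split=> [u Uu|i].
  apply: continuous_comp; last exact: (derivable_k_continuous thetaC).
  exact: (Ck_on_continuous hC Uu).
have [hD hCi] := hC.2 i; split=> [u Uu|].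
  by case: (is_derive_comp (hD u Uu) (thetaD (h u))).
apply: (@eq_Ck_on _ _ _ (fun x => (theta' \o h) x * partial i h x)) => //.
  move=> x Ux; have := is_derive_comp (hD x Ux) (thetaD (h x)).
  by move=> H; rewrite /partial (@derive_val _ _ _ _ _ _ _ H).
by apply: Ck_onM => //; apply: IHk => //; exact: Ck_onW.
Qed.

End CkCalculus.

(** * A smooth step function *)

Section SmoothStep.
Context (R : realType).

Lemma MVT_everywhere (f df : R -> R) (a b : R) :
  (forall t : R, is_derive t 1 f (df t)) -> a <= b ->
  exists c, f b - f a = df c * (b - a).
Proof.
move=> fD ab.
have fc : {within `[a, b], continuous f}.
  apply: continuous_subspaceT => t.
  by apply/differentiable_continuous/derivable1_diffP; case: (fD t).
by have [c _ E] := MVT_segment ab (fun t _ => fD t) fc; exists c.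
Qed.

(** The functions x^-m exp(-1/x) extended by zero to x <= 0: their linear
    combinations are stable under derivation, whence their smoothness. *)
Definition flat (m : nat) (x : R) : R :=
  if 0 < x then x^-1 ^+ m * expR (- x^-1) else 0.

Lemma flat_ge0 m x : 0 <= flat m x.
Proof.
rewrite /flat; case: ifPn => // x0.
by rewrite mulr_ge0 ?expR_ge0// exprn_ge0// invr_ge0 ltW.
Qed.

Lemma expR_pow_le (y : R) j : 0 <= y -> y ^+ j.+1 * expR (- y) <= j.+1`!%:R.
Proof.
move=> y0; rewrite expRN ler_pdivrMr ?expR_gt0//.
rewrite mulrC -ler_pdivrMr ?ltr0n ?fact_gt0//.
by apply: le_trans (expR_ge1Dxn j y0); rewrite lerDr.
Qed.

(** Exponential decay beats any power of 1/x; the bound by x^2 is what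
    differentiability at 0 requires. *)
Lemma flat_le_sqr m x : flat m x <= m.+2`!%:R * x ^+ 2.
Proof.
rewrite /flat; case: ifPn => [x0|_]; last by rewrite mulr_ge0 ?sqr_ge0.
have := expR_pow_le m.+1 (ltW (_ : 0 < x^-1)); rewrite invr_gt0 => /(_ x0).
rewrite -ler_pdivrMr ?exprn_gt0//; apply: le_trans.
by rewrite le_eqVlt -(addn2 m) exprD (exprVn x 2) mulrAC eqxx.
Qed.

Lemma is_derive_flat m (x : R) :
  is_derive x 1 (flat m) (- m%:R * flat m.+1 x + flat m.+2 x).
Proof.
have [x0|x0|<-] := ltgtP 0 x.
- have near0 : \near x, x^-1 ^+ m * expR (- x^-1) = flat m x.
    by near=> t; rewrite /flat ifT//; near: t; exact: lt_nbhsr.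
  apply: near_eq_is_derive near0 _.
  have dV : is_derive x 1 (fun t : R => t^-1) (- x^-1 ^+ 2).
    split; first by apply: derivableV; [rewrite gt_eqF|exact: derivable_id].
    rewrite (@deriveV _ _ (id : R -> R)) ?gt_eqF//.
    by rewrite derive_id [_ *: _]mulr1 exprVn.
  have dG : is_derive (x^-1 : R) 1 (fun y : R => y ^+ m * expR (- y))
      (m%:R * x^-1 ^+ m.-1 * expR (- x^-1) - x^-1 ^+ m * expR (- x^-1)).
    have dE : is_derive (x^-1 : R) 1 (fun y : R => expR (- y)) (- expR (- x^-1)).
      rewrite -mulrN1; apply: (@is_derive1_comp _ expR (@GRing.opp R)).
    have dP : is_derive (x^-1 : R) 1 (fun y : R => y ^+ m) (m%:R * x^-1 ^+ m.-1).
      split; first exact: exprn_derivable.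
      by rewrite exp_derive [_%:A]mulr1.
    apply: (is_derive_eq (is_deriveM dP dE)).
    by rewrite /= ![_ *: _]mulrC; ring.
  apply: (is_derive_eq (is_derive1_comp dG dV)).
  rewrite /flat x0; case: m {dG} => [|m] /=.
    by rewrite !expr0; ring.
  by rewrite !exprS; ring.
- have near0 : \near x, 0 = flat m x.
    near=> t; rewrite /flat ifF//; apply/negbTE; rewrite -leNgt ltW//.
    by near: t; exact: lt_nbhsl.
  apply: near_eq_is_derive near0 _.
  by rewrite /flat !ifF ?mulr0 ?addr0; [exact: is_derive_cst| |];
    apply/negbTE; rewrite -leNgt ltW.
- rewrite /flat ltxx mulr0 addr0.
  have cvg0 : (fun h : R => h^-1 *: ((flat m \o shift 0) h%:A - flat m 0))
      @ 0^' --> (0 : R).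
    apply/cvgrPdist_le => e e0.
    have C0 : (0 : R) < m.+2`!%:R by rewrite ltr0n fact_gt0.
    near=> h.
    have h0 : h != 0 by near: h; exact: nbhs_dnbhs_neq.
    rewrite sub0r normrN /= addr0 [h%:A]mulr1 {2}/flat ltxx subr0.
    rewrite normrM normfV ler_pdivrMl ?normr_gt0//.
    rewrite (ger0_norm (flat_ge0 _ _)); apply: le_trans (flat_le_sqr _ _) _.
    rewrite -(real_normK (num_real h)) expr2 mulrCA ler_wpM2l//.
    rewrite mulrC -ler_pdivlMr//.
    near: h; apply: dnbhs0_le; exact: divr_gt0.
  split; first by apply/cvg_ex; exists 0.
  by apply/cvg_lim.
Unshelve. all: by end_near. Qed.

Lemma derivable_k_lincomb k (a b : R) (f g : R -> R) :
  derivable_k k f -> derivable_k k g -> derivable_k k (fun x => a * f x + b * g x).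
Proof.
elim: k f g => [|k IHk] f g /=.
  by move=> fc gc x; apply: cvgD; apply: cvgMl_tmp; [exact: fc|exact: gc].
move=> [f' fD f'k] [g' gD g'k]; exists (fun x => a * f' x + b * g' x); last exact: IHk.
by move=> t; apply: is_deriveD; apply: is_deriveZ.
Qed.

Lemma flat_derivable_k k m : derivable_k k (flat m).
Proof.
elim: k m => [|k IHk] m.
  move=> x; apply/differentiable_continuous/derivable1_diffP.
  by case: (is_derive_flat m x).
exists (fun x => - m%:R * flat m.+1 x + flat m.+2 x); first exact: is_derive_flat.
rewrite (_ : (fun _ => _) = (fun x => - m%:R * flat m.+1 x + 1 * flat m.+2 x)).
  exact: derivable_k_lincomb.
by apply/funext => x; rewrite mul1r.
Qed.

Lemma flat0_increment (a b : R) : a <= b ->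
  0 <= flat 0 b - flat 0 a <= 2 * (b - a).
Proof.
move=> ab; have [c ->] := MVT_everywhere (is_derive_flat 0) ab.
rewrite oppr0 mul0r add0r mulr_ge0 ?flat_ge0 ?subr_ge0//=.
rewrite ler_wpM2r ?subr_ge0// /flat; case: ifPn => // c0.
by apply: (expR_pow_le 1); rewrite invr_ge0 ltW.
Qed.

(** With h(x) = exp(-1/x) for x > 0 and 0 otherwise, a = h(1), the step is
    t |-> h(a - h(t)) / h(a): it is constant where h vanishes, that is for
    t <= 0, and it vanishes where h(t) >= a. Only compositions occur, no quotient
    of functions. Smoothness is stated as stability of the class C^k under
    composition, the only form in which it is used. *)
Lemma exists_smooth_step : exists theta : R -> R, exists2 L : R, 0 < L &
  [/\ forall t, t <= 0 -> theta t = 1, forall t, 1 <= t -> theta t = 0,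
      forall t, 0 <= theta t <= 1,
      forall s t, `|theta s - theta t| <= L * `|s - t| &
      forall n k (U : set 'rV[R]_n) (h : 'rV[R]_n -> R^o), open U ->
        Ck_on k U h -> Ck_on k U (theta \o h : 'rV[R]_n -> R^o)].
Proof.
pose a := flat 0 1; pose c := flat 0 a.
have flat_gt0 x : 0 < x -> 0 < flat 0 x.
  by move=> x0; rewrite /flat x0 expr0 mul1r expR_gt0.
have flat_le0 x : x <= 0 -> flat 0 x = 0 by move=> x0; rewrite /flat ltNge x0.
have a0 : 0 < a by exact: flat_gt0.
have c0 : 0 < c by exact: flat_gt0.
have flat_mono x y : x <= y -> flat 0 x <= flat 0 y.
  by move=> /flat0_increment/andP[+ _]; rewrite subr_ge0.
have flat_lip x y : `|flat 0 x - flat 0 y| <= 2 * `|x - y|.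
  have [xy|/ltW xy] := leP x y.
    have /andP[h1 h2] := flat0_increment xy.
    by rewrite distrC [ `|x - y|]distrC !ger0_norm// subr_ge0.
  have /andP[h1 h2] := flat0_increment xy.
  by rewrite !ger0_norm// subr_ge0.
exists (fun t => flat 0 (a - flat 0 t) / c), (4 / c); first by rewrite divr_gt0.
split.
- by move=> t /flat_le0 ->; rewrite subr0 divff// gt_eqF.
- by move=> t t1; rewrite [X in X / _]flat_le0 ?mul0r// subr_le0 flat_mono.
- move=> t; rewrite divr_ge0 ?flat_ge0//= ler_pdivrMr// mul1r flat_mono//.
  by rewrite gerBl flat_ge0.
- move=> s t; rewrite -mulrBl normrM normfV (gtr0_norm c0) mulrAC.
  apply: ler_wpM2r; first by rewrite invr_ge0 ltW.
  apply: le_trans (flat_lip _ _) _.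
  rewrite (_ : 4 = 2 * 2 :> R) -?mulrA ?ler_wpM2l//; last by ring.
  rewrite [X in `|X|](_ : _ = flat 0 t - flat 0 s); last by ring.
  by rewrite [ `|s - t|]distrC; exact: flat_lip.
- move=> n k U h oU hC.
  have C1 := Ck_on_comp oU (flat_derivable_k k 0) hC.
  have C2 : Ck_on k U (fun x => a - flat 0 (h x) : R^o).
    have := Ck_onD oU (Ck_on_cst k U (a : R^o)) (Ck_onM oU (Ck_on_cst k U (-1 : R^o)) C1).
    by apply: eq_Ck_on => // x _ /=; rewrite mulN1r.
  have := Ck_onM oU (Ck_on_comp oU (flat_derivable_k k 0) C2) (Ck_on_cst k U (c^-1 : R^o)).
  exact: eq_Ck_on.
Qed.

End SmoothStep.

(** * Positive definite quadratic forms *)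

Section QuadraticForm.
Context (R : realType) (n : nat).
Implicit Types (G : 'M[R]_n) (u v w : 'rV[R]_n).

Definition bform G v w : R := (v *m G *m w^T) 0 0.
Definition qnorm G v : R := Num.sqrt (bform G v v).
Definition spd G : Prop := G^T = G /\ forall v, v != 0 -> 0 < bform G v v.

Lemma bformE G v w : bform G v w = \sum_i \sum_j v 0 i * G i j * w 0 j.
Proof.
rewrite /bform mxE exchange_big; apply: eq_bigr => j _ /=.
by rewrite !mxE mulr_suml.
Qed.

Lemma bformDl G u v w : bform G (u + v) w = bform G u w + bform G v w.
Proof. by rewrite /bform !mulmxDl mxE. Qed.

Lemma bformDr G u v w : bform G w (u + v) = bform G w u + bform G w v.
Proof. by rewrite /bform linearD /= mulmxDr mxE. Qed.

Lemma bformZl G a v w : bform G (a *: v) w = a * bform G v w.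
Proof. by rewrite /bform -!scalemxAl mxE. Qed.

Lemma bformZr G a v w : bform G w (a *: v) = a * bform G w v.
Proof. by rewrite /bform linearZ /= -scalemxAr mxE. Qed.

Lemma bform_sym G v w : G^T = G -> bform G v w = bform G w v.
Proof.
move=> GT; rewrite /bform -[in LHS](trmxK (v *m G)) -trmx_mul mxE.
by rewrite trmx_mul GT mulmxA.
Qed.

Lemma bform_mulmx m (A : 'M[R]_(n, m)) (G : 'M[R]_m) v :
  (v *m (A *m G *m A^T) *m v^T) 0 0 = ((v *m A) *m G *m (v *m A)^T) 0 0.
Proof. by rewrite trmx_mul !mulmxA. Qed.

Lemma bform_ge0 G v : spd G -> 0 <= bform G v v.
Proof.
move=> [_ Gpos]; have [->|/Gpos/ltW//] := eqVneq v 0.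
by rewrite /bform !mul0mx mxE.
Qed.

Lemma bform_ge0_eq G v : spd G -> bform G v v = 0 -> v = 0.
Proof.
move=> [_ Gpos] v0; apply/eqP/negP => /negP /Gpos.
by rewrite v0 ltxx.
Qed.

Lemma qnorm_ge0 G v : 0 <= qnorm G v. Proof. exact: sqrtr_ge0. Qed.

Lemma sqr_qnorm G v : spd G -> qnorm G v ^+ 2 = bform G v v.
Proof. by move=> /bform_ge0 ?; rewrite sqr_sqrtr. Qed.

Lemma qnorm0 G : qnorm G 0 = 0.
Proof. by rewrite /qnorm /bform !mul0mx mxE sqrtr0. Qed.

Lemma qnormZ G a v : qnorm G (a *: v) = `|a| * qnorm G v.
Proof.
by rewrite /qnorm bformZl bformZr mulrA -expr2 sqrtrM ?sqr_ge0// sqrtr_sqr.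
Qed.

Lemma qnormN G v : qnorm G (- v) = qnorm G v.
Proof. by rewrite -scaleN1r qnormZ normrN1 mul1r. Qed.

Lemma qnormBC G v w : qnorm G (v - w) = qnorm G (w - v).
Proof. by rewrite -opprB qnormN. Qed.

Lemma bform_CauchySchwarz G v w : spd G -> `|bform G v w| <= qnorm G v * qnorm G w.
Proof.
move=> Gs; have [w0|w0] := eqVneq w 0.
  by rewrite w0 qnorm0 mulr0 /bform trmx0 mulmx0 mxE normr0.
have W0 : 0 < bform G w w by case: Gs => _; exact.
rewrite -(ler_pXn2r (_ : (0 < 2)%N)) ?nnegrE ?mulr_ge0 ?qnorm_ge0//.
rewrite exprMn !sqr_qnorm// real_normK ?num_real//.
have := bform_ge0 (v - (bform G v w / bform G w w) *: w) Gs.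
rewrite -scaleNr !(bformDl, bformDr, bformZl, bformZr) (@bform_sym G w v); last by case: Gs.
move=> H; rewrite -subr_ge0 -(pmulr_rge0 _ (_ : 0 < (bform G w w)^-1)) ?invr_gt0//.
by apply: le_trans H _; rewrite le_eqVlt; apply/orP; left; apply/eqP; field; rewrite gt_eqF.
Qed.

Lemma qnormD G v w : spd G -> qnorm G (v + w) <= qnorm G v + qnorm G w.
Proof.
move=> Gs; rewrite -(ler_pXn2r (_ : (0 < 2)%N)) ?nnegrE ?addr_ge0 ?qnorm_ge0//.
rewrite sqrrD !sqr_qnorm// bformDl !bformDr (@bform_sym G w v); last by case: Gs.
have := le_trans (ler_norm _) (bform_CauchySchwarz v w Gs).
by move=> H; lra.
Qed.

Lemma qnorm_triangle G u v w : spd G ->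
  qnorm G (u - w) <= qnorm G (u - v) + qnorm G (v - w).
Proof. by move=> Gs; apply: le_trans (qnormD _ _ Gs); rewrite addrA subrK. Qed.

Lemma ler_dist_qnorm G v w : spd G -> `|qnorm G v - qnorm G w| <= qnorm G (v - w).
Proof.
move=> Gs; have := qnormD (v - w) w Gs; have := qnormD (w - v) v Gs.
rewrite !subrK (qnormBC _ w v) => H1 H2.
by rewrite ler_norml; apply/andP; split; lra.
Qed.

Lemma ler_norm_mulmx (B : 'M[R]_n) v :
  `|v *m B| <= (\sum_i \sum_j `|B i j|) * `|v|.
Proof.
apply: ler_rVnorm => [|j].
  by rewrite mulr_ge0// sumr_ge0// => i _; apply: sumr_ge0.
rewrite mxE; apply: le_trans (ler_norm_sum _ _ _) _; rewrite mulr_suml.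
apply: ler_sum => i _; rewrite normrM mulrC ler_pM ?ler_coord_norm//.
by rewrite (bigD1 j)//= lerDl sumr_ge0.
Qed.

Lemma bform_dist_le G G' v (d : R) : (forall i j, `|G i j - G' i j| <= d) ->
  `|bform G v v - bform G' v v| <= n%:R * n%:R * d * `|v| ^+ 2.
Proof.
move=> Gd; rewrite !bformE -sumrB; apply: le_trans (ler_norm_sum _ _ _) _.
rewrite (_ : n%:R * n%:R * d * `|v| ^+ 2 = \sum_(i < n) \sum_(j < n) d * `|v| ^+ 2).
  apply: ler_sum => i _; rewrite -sumrB; apply: le_trans (ler_norm_sum _ _ _) _.
  apply: ler_sum => j _.
  rewrite (_ : _ - _ = (G i j - G' i j) * (v 0 i * v 0 j)); last by ring.
  by rewrite normrM normrM expr2 !ler_pM ?mulr_ge0 ?ler_coord_norm.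
by rewrite !sumr_const card_ord -[X in _ = X *+ n]mulr_natl -[RHS]mulr_natl; ring.
Qed.

Lemma qnorm_le_norm G : exists2 C : R, 0 < C & forall v, qnorm G v <= C * `|v|.
Proof.
pose d := \sum_i \sum_j `|G i j|.
have d0 : 0 <= d by apply: sumr_ge0 => i _; apply: sumr_ge0.
have Gd i j : `|G i j - (0 : 'M[R]_n) i j| <= d.
  rewrite mxE subr0 /d (bigD1 i)//= (bigD1 j)//= -addrA lerDl addr_ge0//.
    exact: sumr_ge0.
  by apply: sumr_ge0 => ? _; apply: sumr_ge0.
have C0 : 0 <= n%:R * n%:R * d by rewrite !mulr_ge0.
exists (Num.sqrt (n%:R * n%:R * d + 1)); first by rewrite sqrtr_gt0 ltr_wpDl.
move=> v; have := bform_dist_le v Gd.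
rewrite {2}/bform mulmx0 mul0mx mxE subr0 => H.
rewrite -[ `|v|]normr_id -sqrtr_sqr -sqrtrM ?ler_wsqrtr ?addr_ge0//.
by apply: le_trans (ler_norm _) _; apply: le_trans H _; rewrite ler_wpM2r ?sqr_ge0// lerDl.
Qed.

Lemma spd_unitmx G : spd G -> G \in unitmx.
Proof.
move=> Gs; rewrite -row_free_unit -kermx_eq0; apply/rowV0P => v /sub_kermxP vG.
by apply: (bform_ge0_eq Gs); rewrite /bform vG mul0mx mxE.
Qed.

(** The coordinates of [v *m G] are the values of the form at [v] and the basis
    vectors, which Cauchy-Schwarz bounds by [qnorm G v]; multiply by the inverse
    of [G] to recover [v]. *)
Lemma norm_le_qnorm G : spd G -> exists2 c : R, 0 < c & forall v, c * `|v| <= qnorm G v.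
Proof.
move=> Gs; have Gu := spd_unitmx Gs.
pose B := \sum_i \sum_j `|invmx G i j|; pose S := \sum_j qnorm G (delta_mx 0 j).
have B0 : 0 <= B by apply: sumr_ge0 => i _; apply: sumr_ge0.
have S0 : 0 <= S by apply: sumr_ge0 => i _; exact: qnorm_ge0.
have D0 : 0 < B * S + 1 by rewrite ltr_wpDl// mulr_ge0.
exists (B * S + 1)^-1; first by rewrite invr_gt0.
move=> v; rewrite ler_pdivrMl// -{1}(mulmxK Gu v).
apply: le_trans (ler_norm_mulmx _ _) _.
apply: (@le_trans _ _ (B * (S * qnorm G v))); last first.
  by rewrite mulrA ler_wpM2r ?qnorm_ge0// lerDl.
rewrite ler_wpM2l//; apply: ler_rVnorm => [|j]; first by rewrite mulr_ge0 ?qnorm_ge0.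
have -> : (v *m G) 0 j = bform G v (delta_mx 0 j).
  by rewrite /bform trmx_delta -colE [RHS]mxE.
apply: le_trans (bform_CauchySchwarz _ _ Gs) _.
rewrite mulrC ler_wpM2r ?qnorm_ge0// /S (bigD1 j)//= lerDl.
by apply: sumr_ge0 => i _; exact: qnorm_ge0.
Qed.

(** A perturbation of the coefficients changes the form by a small multiple of
    [`|v| ^+ 2], which the form itself dominates; half of it is enough for the
    factor 2 on the norms. *)
Lemma qnorm_compare G0 : spd G0 -> exists2 d : R, 0 < d &
  forall G, (forall i j, `|G i j - G0 i j| <= d) ->
  forall v, qnorm G v <= 2 * qnorm G0 v /\ qnorm G0 v <= 2 * qnorm G v.
Proof.
move=> Gs; have [c c0 cG] := norm_le_qnorm Gs.
pose N : R := n%:R * n%:R + 1.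
have N0 : 0 < N by rewrite ltr_wpDl// mulr_ge0.
exists (c ^+ 2 / (2 * N)); first by rewrite divr_gt0 ?exprn_gt0 ?mulr_gt0.
move=> G /bform_dist_le GG v; have := GG v.
have cv : c ^+ 2 * `|v| ^+ 2 <= bform G0 v v.
  rewrite -exprMn -sqr_qnorm// ler_pXn2r ?nnegrE ?qnorm_ge0 ?mulr_ge0//; exact: ltW.
have : n%:R * n%:R * (c ^+ 2 / (2 * N)) * `|v| ^+ 2 <= 2^-1 * bform G0 v v.
  rewrite (_ : n%:R * n%:R * (c ^+ 2 / (2 * N)) * `|v| ^+ 2 =
    2^-1 * (n%:R * n%:R / N) * (c ^+ 2 * `|v| ^+ 2)); last by field; rewrite gt_eqF.
  rewrite -mulrA ler_wpM2l ?invr_ge0// -[leRHS]mul1r ler_pM//.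
  - by rewrite divr_ge0 ?(ltW N0) ?mulr_ge0.
  - by rewrite mulr_ge0 ?sqr_ge0.
  - by rewrite ler_pdivrMr// mul1r lerDl.
move=> H1 H2; have {H2} := le_trans H2 H1; rewrite ler_norml => /andP[H1' H2'].
have G00 := bform_ge0 v Gs.
have S2 : 2 = Num.sqrt 4 :> R.
  by rewrite (_ : 4 = 2 ^+ 2 :> R) ?sqrtr_sqr ?ger0_norm//; ring.
by split; rewrite /qnorm S2 -sqrtrM// ler_wsqrtr//; lra.
Qed.

Lemma qnorm_continuous G u0 u : spd G ->
  {for u, continuous (fun v : 'rV[R]_n => qnorm G (v - u0))}.
Proof.
move=> Gs; have [C C0 CG] := qnorm_le_norm G.
apply/(@cvgrPdist_le _ R^o _ _ (nbhs_filter u)) => e e0.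
apply: filterS (nbhsx_ballx (u : 'rV[R]_n) (e / C) (divr_gt0 e0 C0)) => v.
rewrite -ball_normE/= => /ltW uv.
apply: le_trans (ler_dist_qnorm _ _ Gs) _; rewrite opprB addrA subrK.
by apply: le_trans (CG _) _; rewrite mulrC -ler_pdivlMr.
Qed.

(** The segment from the identity to a positive definite matrix consists of
    invertible matrices, so the determinant keeps its sign along it. *)
Lemma spd_det_gt0 G : spd G -> 0 < \det G.
Proof.
move=> Gs; rewrite ltNge; apply/negP => detG.
pose P : 'M[{poly R}]_n := \matrix_(i, j) ((1 - 'X) * ((i == j)%:R)%:P + 'X * (G i j)%:P).
have PE t : (\det P).[t] = \det ((1 - t)%:M + t *: G).
  rewrite -[LHS]/(horner_eval t (\det P)) -det_map_mx; congr (\det _).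
  by apply/matrixP => i j; rewrite !mxE /= /horner_eval !hornerE mulr_natr.
have H : (- \det P).[0] <= 0 <= (- \det P).[1].
  rewrite !hornerN !PE subr0 scale0r addr0 det1 subrr scale1r.
  by rewrite oppr_le0 ler01 oppr_ge0 -scalemx1 scale0r add0r.
have [x /andP[x0 x1]] := poly_ivt ler01 H.
rewrite rootE hornerN oppr_eq0 PE => /det0P[v v0 vP].
have : bform ((1 - x)%:M + x *: G) v v = 0 by rewrite /bform vP mul0mx mxE.
have -> : bform ((1 - x)%:M + x *: G) v v = (1 - x) * bform 1%:M v v + x * bform G v v.
  rewrite /bform mulmxDr mulmxDl mxE mul_mx_scalar -!scalemxAl mxE mulmx1.
  by congr (_ + _); rewrite -scalemxAr -scalemxAl mxE.
have v1 : 0 < bform 1%:M v v.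
  rewrite /bform mulmx1 mxE; under eq_bigr do rewrite mxE -expr2.
  rewrite lt_def sumr_ge0 => [|i _]; last exact: sqr_ge0.
  rewrite andbT; apply: contra v0 => /eqP /psumr_eq0P s0; apply/eqP/rowP => i.
  by apply/eqP; rewrite mxE -sqrf_eq0 s0// => j _; exact: sqr_ge0.
have vG : 0 < bform G v v by case: Gs => _; exact.
move=> /eqP; rewrite paddr_eq0 ?mulr_ge0 ?subr_ge0// ?ltW//.
rewrite !mulf_eq0 !(gt_eqF v1, gt_eqF vG) !orbF subr_eq0 => /andP[/eqP <-].
by rewrite oner_eq0.
Qed.

End QuadraticForm.

(** * Charts and the speed of curves *)

Section Charts.
Context (R : realType) (n : nat) (M : topologicalType).
Context (X : smooth_manifold R n M).
Implicit Types (c : chart X) (x : M) (u : 'rV[R]_n).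

Lemma chart_map_cod c x : chart_dom c x -> chart_cod c (chart_map c x).
Proof. by move=> cx; exists x. Qed.

Lemma chart_invK c u : chart_cod c u -> chart_map c (chart_inv c u) = u.
Proof. by move=> [x cx <-]; rewrite chart_mapK. Qed.

Lemma chart_inv_dom c u : chart_cod c u -> chart_dom c (chart_inv c u).
Proof. by move=> [x cx <-]; rewrite chart_mapK. Qed.

Lemma chart_dom_nbhs c x : chart_dom c x -> nbhs x (chart_dom c).
Proof. by move=> cx; apply: open_nbhs_nbhs; split=> //; exact: chart_dom_open. Qed.

Lemma chart_cod_nbhs c u : chart_cod c u -> nbhs u (chart_cod c).
Proof. by move=> cu; apply: open_nbhs_nbhs; split=> //; exact: chart_cod_open. Qed.

Lemma chart_map_open c (O : set M) : open O ->
  open (chart_map c @` (chart_dom c `&` O)).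
Proof.
move=> oO; rewrite openE => _ [x [cx Ox] <-].
have cu := chart_map_cod cx.
have ic := chart_inv_continuous cu.
have : nbhs (chart_map c x) (chart_inv c @^-1` O).
  by apply: ic; rewrite chart_mapK//; apply: open_nbhs_nbhs.
rewrite /interior; apply: filterS2 (chart_cod_nbhs cu) => v cv Ov.
exists (chart_inv c v); last exact: chart_invK.
by split=> //; exact: chart_inv_dom.
Qed.

Lemma chart_inv_open c (U : set 'rV[R]_n) : open U -> U `<=` chart_cod c ->
  open (chart_inv c @` U).
Proof.
move=> oU Uc; rewrite openE => _ [u Uu <-].
have cu := Uc _ Uu; have cx := chart_inv_dom cu.
have mc := chart_map_continuous cx.
have : nbhs (chart_inv c u) (chart_map c @^-1` U).
  by apply: mc; rewrite chart_invK//; apply: open_nbhs_nbhs.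
rewrite /interior; apply: filterS2 (chart_dom_nbhs cx) => y cy Uy.
by exists (chart_map c y) => //; exact: chart_mapK.
Qed.

Lemma chart_inv_compact c (C : set 'rV[R]_n) : compact C -> C `<=` chart_cod c ->
  compact (chart_inv c @` C).
Proof.
move=> Cc CU; apply: continuous_compact => //.
apply: continuous_in_subspaceT => u; rewrite inE => /CU.
exact: chart_inv_continuous.
Qed.

Lemma chart_inv_closed c (C : set 'rV[R]_n) : compact C -> C `<=` chart_cod c ->
  closed (chart_inv c @` C).
Proof.
move=> Cc CU; apply: compact_closed; first exact: manifold_hausdorff X.
exact: chart_inv_compact.
Qed.

Lemma transition_open c c' : open (chart_map c @` (chart_dom c `&` chart_dom c')).
Proof. by apply: chart_map_open; exact: chart_dom_open. Qed.

Lemma transition_differentiable c c' x : chart_dom c x -> chart_dom c' x ->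
  differentiable (chart_map c' \o chart_inv c) (chart_map c x).
Proof.
move=> cx c'x.
apply: (C1_differentiable_row (@transition_open c c')); last by exists x.
exact: transition_smooth.
Qed.

Lemma transition_near (T : topologicalType) (gamma : T -> M) c c' t :
  {for t, continuous gamma} -> chart_dom c (gamma t) ->
  \near t, ((chart_map c' \o chart_inv c) \o (chart_map c \o gamma)) t =
           (chart_map c' \o gamma) t.
Proof.
move=> gc ct; have : \near t, chart_dom c (gamma t) by apply: gc; exact: chart_dom_nbhs.
by apply: filterS => s cs /=; rewrite chart_mapK.
Qed.

(** Differentiability of the transition map is needed here: without it the
    Jacobian in [transition_jacobian] would carry no information. *)
Lemma is_derive_chart_change (gamma : R -> M) c c' (t : R) :
  {for t, continuous gamma} -> chart_dom c (gamma t) -> chart_dom c' (gamma t) ->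
  derivable (chart_map c \o gamma) t 1 ->
  is_derive t 1 (chart_map c' \o gamma)
    ('D_1 (chart_map c \o gamma) t *m transition_jacobian c c' (gamma t)).
Proof.
move=> gc ct c't gD; apply: near_eq_is_derive (transition_near c' gc ct) _.
have TD := transition_differentiable ct c't.
have gD' : differentiable (chart_map c \o gamma) t by exact/derivable1_diffP.
split.
  by apply/derivable1_diffP; exact: differentiable_comp.
rewrite deriveE; last exact: differentiable_comp.
rewrite diff_comp//= -(deriveE (1 : R) gD') -deriveE//.
by rewrite deriveEjacobian.
Qed.

End Charts.

Section Speed.
Context (R : realType) (n : nat) (M : topologicalType).
Context (X : smooth_manifold R n M) (g : riemannian_metric X).
Implicit Types (c : chart X) (x : M) (u : 'rV[R]_n) (gamma : R -> M).

Lemma gram_spd c u : chart_cod c u -> spd (gram g c u).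
Proof.
move=> cu; split; first exact: gram_sym.
by move=> v v0; exact: gram_posdef.
Qed.

Lemma gram_at_spd x : spd (gram_at g x).
Proof. exact/gram_spd/chart_map_cod/chart_at_dom. Qed.

Lemma tnormE x (v : tangent X x) : tnorm g v = qnorm (gram_at g x) v.
Proof. by []. Qed.

Lemma gram_continuous c u i j : chart_cod c u ->
  {for u, continuous (fun v => gram g c v i j : R^o)}.
Proof. by move=> cu; apply: Ck_on_continuous cu; exact: (gram_smooth g c i j 0). Qed.

(** The chain rule and the transformation law of the Gram matrices cancel: the
    speed can be computed in any chart around the point, not only in the chart
    selected by [chart_at], which may vary discontinuously along the curve. *)
Lemma tnorm_velocity c gamma (t : R) :
  {for t, continuous gamma} -> chart_dom c (gamma t) ->
  derivable (chart_map (chart_at X (gamma t)) \o gamma) t 1 ->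
  tnorm g (velocity X gamma t) =
  qnorm (gram g c (chart_map c (gamma t))) ('D_1 (chart_map c \o gamma) t).
Proof.
move=> gc ct gD; rewrite /tnorm /qnorm; congr Num.sqrt.
have atx := chart_at_dom X (gamma t).
rewrite (@derive_val _ _ _ _ _ _ _ (is_derive_chart_change gc atx ct gD)).
by rewrite /inner /bform /gram_at (gram_transition g atx ct) bform_mulmx.
Qed.

Lemma continuous_qnorm (T : topologicalType) (G : T -> 'M[R]_n) (v : T -> 'rV[R]_n)
    (t : T) : (forall i j, {for t, continuous (fun s => G s i j : R^o)}) ->
  {for t, continuous v} -> {for t, continuous (fun s => qnorm (G s) (v s) : R^o)}.
Proof.
move=> Gc vc; have vci i : {for t, continuous (fun s => v s 0 i : R^o)}.
  exact: (continuous_comp vc (@coord_continuous _ _ _ 0 i _)).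
have bc : {for t, continuous (fun s => bform (G s) (v s) (v s) : R^o)}.
  rewrite (_ : (fun s => _) = fun s => \sum_i \sum_j v s 0 i * G s i j * v s 0 j).
    do 2![apply: continuous_at_sum => ?].
    exact: cvgM (cvgM (vci _) (Gc _ _)) (vci _).
  by apply/funext => s; rewrite bformE.
exact: (continuous_comp bc (@sqrt_continuous _ _)).
Qed.

Lemma C1_curve_derivable c gamma (t : R) : C1_curve X gamma -> 0 <= t <= 1 ->
  chart_dom c (gamma t) -> derivable (chart_map c \o gamma) t 1.
Proof. by move=> gC t01 ct; have [_ /(_ c ct)[+ _]] := gC t t01; exact: nbhs_singleton. Qed.

Lemma C1_curve_tnorm c gamma (t : R) : C1_curve X gamma -> 0 <= t <= 1 ->
  chart_dom c (gamma t) ->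
  tnorm g (velocity X gamma t) =
  qnorm (gram g c (chart_map c (gamma t))) ('D_1 (chart_map c \o gamma) t).
Proof.
move=> gC t01 ct; have [gc _] := gC t t01; apply: tnorm_velocity => //.
by apply: C1_curve_derivable => //; exact: chart_at_dom.
Qed.

Lemma speed_continuous gamma : C1_curve X gamma ->
  {within `[0, 1], continuous (fun t => tnorm g (velocity X gamma t))}.
Proof.
move=> gC; apply/subspace_continuousP => t; rewrite /= in_itv/= => t01.
pose c := chart_at X (gamma t); have ct : chart_dom c (gamma t) by exact: chart_at_dom.
have [gc /(_ c ct)[_ Dc]] := gC t t01.
rewrite /from_subspace (C1_curve_tnorm gC t01 ct).
have cgc : {for t, continuous (chart_map c \o gamma)}.
  by apply: continuous_comp gc _; exact: chart_map_continuous.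
have qc := @continuous_qnorm _ (fun s => gram g c (chart_map c (gamma s))) _ t
   (fun i j => continuous_comp cgc (@gram_continuous c _ i j (chart_map_cod ct))) Dc.
pose q (s : R) := qnorm (gram g c (chart_map c (gamma s))) ('D_1 (chart_map c \o gamma) s).
apply: (@cvg_trans _ (q @ within `[0, 1] (nbhs t))); last exact: cvg_within_filter qc.
apply: near_eq_cvg; rewrite near_withinE.
have : \near t, chart_dom c (gamma t) by apply: gc; exact: chart_dom_nbhs.
by apply: filterS => s cs; rewrite /= in_itv/= => s01; rewrite (C1_curve_tnorm gC s01 cs).
Qed.

End Speed.

(** * Comparison of the distance with a chart *)

(** The integral of a nonnegative function is a supremum over the simple functions
    below it, hence monotone even on functions that are not measurable. *)
Lemma ge0_le_integral_any d (R : realType) (T : measurableType d) (mu : {measure set T -> \bar R})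
    (D : set T) (f1 f2 : T -> \bar R) : (forall x, D x -> 0 <= f1 x)%E ->
  (forall x, D x -> f1 x <= f2 x)%E ->
  (\int[mu]_(x in D) f1 x <= \int[mu]_(x in D) f2 x)%E.
Proof.
move=> f10 f12; have f20 x : D x -> (0 <= f2 x)%E.
  by move=> Dx; apply: le_trans (f12 x Dx); exact: f10.
rewrite !ge0_integralE//; apply: le_ereal_sup => _ [h hf <-]; exists h => // x.
apply: le_trans (hf x) _; rewrite !patchE; case: ifPn => // xD.
by apply: f12; rewrite inE in xD.
Qed.

Section LocalComparison.
Context (R : realType) (n : nat) (M : topologicalType).
Context (X : smooth_manifold R n M) (g : riemannian_metric X).
Implicit Types (c : chart X) (x y : M) (u v : 'rV[R]_n) (gamma : R -> M).

(** On such a neighborhood the chart can be treated as a Euclidean space with the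
    constant form [gram g c u0], at the cost of a factor 2; taking balls
    of that form as neighborhoods makes the triangle inequality available. *)
Definition good_radius c u0 (s : R) : Prop :=
  forall u, qnorm (gram g c u0) (u - u0) < s -> chart_cod c u /\
  forall v, qnorm (gram g c u) v <= 2 * qnorm (gram g c u0) v /\
            qnorm (gram g c u0) v <= 2 * qnorm (gram g c u) v.

Lemma exists_good_radius c u0 : chart_cod c u0 ->
  exists2 s : R, 0 < s & good_radius c u0 s.
Proof.
move=> cu0; have Gs := gram_spd g cu0.
have [d d0 Hd] := qnorm_compare Gs; have [k k0 Hk] := norm_le_qnorm Gs.
have : \forall u \near u0, chart_cod c u /\
    forall i j, `|gram g c u i j - gram g c u0 i j| <= d.
  apply: filterI; first exact: chart_cod_nbhs.
  apply: (@filter_forall _ _ (fun (i : 'I_n) u => forall j : 'I_n,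
    `|gram g c u i j - gram g c u0 i j| <= d) _ (nbhs_filter u0)) => i.
  apply: (@filter_forall _ _ (fun (j : 'I_n) u =>
    `|gram g c u i j - gram g c u0 i j| <= d) _ (nbhs_filter u0)) => j.
  have /cvgrPdist_le/(_ _ d0) := @gram_continuous _ _ _ _ g c u0 i j cu0.
  by apply: filterS => u; rewrite distrC.
move=> /nbhs_ballP[r /= r0 Hr]; exists (k * r); first exact: mulr_gt0.
move=> u uu0; have /Hr[cu Gu] : ball u0 r u.
  rewrite -ball_normE /= distrC -(ltr_pM2l k0); apply: le_lt_trans uu0; exact: Hk.
by split=> // v; have [] := Hd _ Gu v.
Qed.

Lemma curve_length_ge0 gamma : (0 <= curve_length g gamma)%E.
Proof. by apply: integral_ge0 => t _; rewrite lee_fin tnormE qnorm_ge0. Qed.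

Lemma path_length_ge0 x y l : piecewise_C1_path g x y l -> (0 <= l)%E.
Proof. by elim=> // gamma z k _ _ k0; rewrite adde_ge0 ?curve_length_ge0. Qed.

Lemma bformBl (G : 'M[R]_n) u v w : bform G (u - v) w = bform G u w - bform G v w.
Proof. by rewrite bformDl -scaleN1r bformZl mulN1r. Qed.

Lemma is_derive_affine u v (t : R) : is_derive t 1 (fun s : R => u + s *: v) v.
Proof.
have idD : derivable (@id 'rV[R]_n) (u + t *: v) v by exact: derivable_id.
by have := is_derive_line idD; rewrite derive_id.
Qed.

Lemma is_derive_bform (f : R -> 'rV[R]_n) (G : 'M[R]_n) w (t : R) : derivable f t 1 ->
  is_derive t 1 (fun s => bform G (f s) w : R) (bform G ('D_1 f t) w).
Proof.
move=> fD; have E v : bform G v w = \sum_i (G *m w^T) i 0 * v 0 i.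
  by rewrite /bform -mulmxA mxE; apply: eq_bigr => i _; rewrite mulrC.
have fDi i : is_derive t 1 (fun s => f s 0 i : R) ('D_1 f t 0 i).
  split; first by move/derivable_mxP: fD.
  by rewrite derive_mx// mxE.
have := @is_derive_sum _ _ _ n (fun i => (G *m w^T) i 0 *: (fun s => f s 0 i : R)) t 1 _
  (fun i => is_deriveZ _ (fDi i)).
by rewrite E; congr (is_derive _ _ _ _); apply/funext => s; rewrite E fct_sumE.
Qed.

(** The derivative of the scalar function bform (f s) w along the curve, w being
    the total increment, is at most [qnorm w] times the speed by Cauchy-Schwarz;
    integrate and divide by [qnorm w]. *)
Lemma chart_increment_le c gamma (G0 : 'M[R]_n) (t : R) : spd G0 ->
  C1_curve X gamma -> 0 <= t <= 1 ->
  (forall s, 0 <= s <= t -> chart_dom c (gamma s) /\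
     forall v, qnorm G0 v <= 2 * qnorm (gram g c (chart_map c (gamma s))) v) ->
  ((qnorm G0 (chart_map c (gamma t) - chart_map c (gamma 0)))%:E
    <= 2%:E * curve_length g gamma)%E.
Proof.
move=> Gs gC /andP[t0 t1] Hs; set f := chart_map c \o gamma.
rewrite -[chart_map c (gamma t)]/(f t) -[chart_map c (gamma 0)]/(f 0).
have L0 := curve_length_ge0 gamma.
set w := f t - f 0; set W := qnorm G0 w; have W0 : 0 <= W by exact: qnorm_ge0.
have [tpos|t0'] := ltP 0 t; last first.
  have t0E : t = 0 by apply/eqP; rewrite eq_le t0' t0.
  by rewrite /W /w t0E subrr qnorm0 mule_ge0.
have st s : 0 <= s <= t -> 0 <= s <= 1.
  by move=> /andP[-> st]; rewrite (le_trans st).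
have fD s : 0 <= s <= t -> derivable f s 1.
  by move=> s0t; apply: (C1_curve_derivable gC (st _ s0t)); have [] := Hs s s0t.
pose h s := bform G0 (f s) w; pose h' s := bform G0 ('D_1 f s) w.
have hD s : 0 <= s <= t -> is_derive s 1 h (h' s).
  by move=> /fD; exact: is_derive_bform.
have hc s : 0 <= s <= t -> {for s, continuous h}.
  move=> /hD[hDs _]; apply/differentiable_continuous.
  exact/derivable1_diffP.
have h'c : {within `[0, t], continuous h'}.
  apply: continuous_in_subspaceT => s; rewrite inE/= in_itv/= => s0t.
  have [cs _] := Hs s s0t; have [_ /(_ c cs)[_ Dc]] := gC s (st s s0t).
  have E v : bform G0 v w = \sum_i v 0 i * (G0 *m w^T) i 0.
    by rewrite /bform -mulmxA mxE.
  rewrite (_ : h' = fun s => \sum_i 'D_1 f s 0 i * (G0 *m w^T) i 0); last first.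
    by apply/funext => r; rewrite /h' E.
  apply: (@continuous_at_sum _ _ R^o) => i.
  apply: cvgMr_tmp; exact: (continuous_comp Dc (@coord_continuous _ _ _ 0 i _)).
have spc : {within `[0, t], continuous (fun s => tnorm g (velocity X gamma s))}.
  apply: continuous_subspaceW (@speed_continuous _ _ _ _ g gamma gC).
  by move=> s /=; rewrite !in_itv/=; exact: st.
have FTC : (\int[lebesgue_measure]_(s in `[0%R, t]) (h' s)%:E = (W ^+ 2)%:E)%E.
  rewrite (continuous_FTC2 tpos h'c _ (F := h)).
  - by rewrite -EFinB /W sqr_qnorm// /h -bformBl.
  - split.
    + move=> s; rewrite in_itv/= => /andP[s0 s1].
      by have [] := hD s; rewrite ?ltW.
    + by apply: cvg_at_right_filter; apply: hc; rewrite lexx.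
    + by apply: cvg_at_left_filter; apply: hc; rewrite lexx t0.
  - move=> s; rewrite in_itv/= => /andP[s0 s1]; rewrite derive1E.
    have s0t : 0 <= s <= t by rewrite !ltW.
    by have [_ ->] := hD s s0t.
have k_int : lebesgue_measure.-integrable `[0, t] (EFin \o h').
  by apply: continuous_compact_integrable => //; exact: segment_compact.
have sp_int : lebesgue_measure.-integrable `[0, t]
    (EFin \o (fun s => tnorm g (velocity X gamma s))).
  by apply: continuous_compact_integrable => //; exact: segment_compact.
have I1 : ((W ^+ 2)%:E <= (2 * W)%:E * curve_length g gamma)%E.
  rewrite -FTC; apply: le_trans (_ : _ <= \int[lebesgue_measure]_(s in `[0%R, t])
     ((2 * W)%:E * (tnorm g (velocity X gamma s))%:E))%E _.
    apply: le_integral => //; first exact: integrableZl.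
    move=> s; rewrite inE/= in_itv/= => s0t; rewrite -EFinM lee_fin /h'.
    have [cs Gcs] := Hs s s0t; rewrite (C1_curve_tnorm g gC (st s s0t) cs).
    apply: le_trans (ler_norm _) _; apply: le_trans (bform_CauchySchwarz _ _ Gs) _.
    by rewrite mulrAC ler_wpM2r// Gcs.
  rewrite integralZl//; apply: lee_wpmul2l; first by rewrite lee_fin mulr_ge0.
  apply: ge0_subset_integral => //.
  - have /integrableP[] // := continuous_compact_integrable
      (@segment_compact R 0 1) (@speed_continuous _ _ _ _ g gamma gC).
  - by move=> s _; rewrite lee_fin tnormE qnorm_ge0.
have [->|Wn0] := eqVneq W 0; first by rewrite mule_ge0.
have Wgt0 : 0 < W by rewrite lt_def Wn0.
move: I1 L0; case: (curve_length g gamma) => [l||//].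
  rewrite -!EFinM !lee_fin => I1 l0.
  by rewrite -(ler_pM2l Wgt0) -expr2 mulrCA mulrA.
by move=> _ _; rewrite gt0_muley ?lte_fin// leey.
Qed.

Lemma qnorm_closed_ball_compact (G : 'M[R]_n) u0 (r : R) : spd G ->
  compact [set u | qnorm G (u - u0) <= r].
Proof.
move=> Gs; apply: bounded_closed_compact.
  have [k k0 Hk] := norm_le_qnorm Gs.
  exists (`|u0| + r / k); split; first exact: num_real.
  move=> b rb u /= ur; apply: le_trans (ltW rb).
  rewrite -[u](subrK u0) addrC; apply: le_trans (ler_normD _ _) _.
  rewrite lerD2l ler_pdivlMr// mulrC; exact: le_trans (Hk _) ur.
have -> : [set u | qnorm G (u - u0) <= r] =
    (fun u : 'rV[R]_n => qnorm G (u - u0)) @^-1` [set s | s <= r] by [].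
by apply: closed_comp; [move=> u _; exact: qnorm_continuous|exact: closed_le].
Qed.

Lemma qnorm_ball_open (G : 'M[R]_n) u0 (r : R) : spd G ->
  open [set u | qnorm G (u - u0) < r].
Proof.
move=> Gs; have -> : [set u | qnorm G (u - u0) < r] =
    (fun u : 'rV[R]_n => qnorm G (u - u0)) @^-1` [set s | s < r] by [].
by apply: open_comp; [move=> u _; exact: qnorm_continuous|exact: open_lt].
Qed.

Lemma qnorm_ball_center c u0 (s : R) : 0 < s -> good_radius c u0 s -> chart_cod c u0.
Proof. by move=> s0 gs; have [] := gs u0; rewrite ?subrr ?qnorm0. Qed.

(** A curve that is too short cannot leave the chart: at the first exit time
    it would be a limit of points of a compact part of the chart. *)
Lemma curve_stays c u0 (s l : R) gamma : good_radius c u0 s -> C1_curve X gamma ->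
  chart_dom c (gamma 0) -> curve_length g gamma = l%:E ->
  qnorm (gram g c u0) (chart_map c (gamma 0) - u0) + 2 * l < s ->
  chart_dom c (gamma 1) /\
  qnorm (gram g c u0) (chart_map c (gamma 1) - chart_map c (gamma 0)) <= 2 * l.
Proof.
move=> gs gC c0 gl; set G := gram g c u0; set a := qnorm G _ => als.
have l0 : 0 <= l by rewrite -lee_fin -gl curve_length_ge0.
have s0 : 0 < s by apply: le_lt_trans als; rewrite addr_ge0 ?mulr_ge0 ?qnorm_ge0.
have Gs : spd G by apply/gram_spd/(qnorm_ball_center s0 gs).
pose N := [set x | chart_dom c x /\ qnorm G (chart_map c x - u0) < s].
have oN : open N.
  have -> : N = chart_inv c @` [set u | qnorm G (u - u0) < s].
    apply/seteqP; split=> [x [cx xs]|_ [u /= us <-]].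
      by exists (chart_map c x) => //; exact: chart_mapK.
    by have [cu _] := gs u us; split; [exact: chart_inv_dom|rewrite chart_invK].
  apply: chart_inv_open; first exact: qnorm_ball_open.
  by move=> u /= /gs[].
have incr t : 0 <= t <= 1 -> (forall r, 0 <= r <= t -> N (gamma r)) ->
    qnorm G (chart_map c (gamma t) - chart_map c (gamma 0)) <= 2 * l.
  move=> t01 Nt; rewrite -lee_fin EFinM -gl.
  apply: chart_increment_le => // r /Nt[cr rs]; split=> // v.
  by have [_ /(_ v)[]] := gs _ rs.
suff allN t : 0 <= t <= 1 -> N (gamma t).
  split; first by have [] := allN 1; rewrite ?ler01 ?lexx.
  apply: incr; first by rewrite ler01 lexx.
  by move=> r; exact: allN.
apply: contraPP => notN t01.
pose Z := [set r | 0 <= r <= 1 /\ ~ N (gamma r)].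
have Zinf : has_inf Z by split; [exists t|exists 0 => r [/andP[]]].
(* [e] is the first exit time from [N]. *)
pose e := inf Z.
have e0 : 0 <= e by apply: lb_le_inf; [exists t|move=> r [/andP[]]].
have et : e <= t by apply: ge_inf; [exact: Zinf.2|].
have e01 : 0 <= e <= 1 by rewrite e0 (le_trans et)//; case/andP: t01.
have before r : 0 <= r < e -> N (gamma r).
  move=> /andP[r0 re]; apply: contrapT => Nr.
  have : e <= r.
    apply: ge_inf; first exact: Zinf.2.
    by split=> //; rewrite r0 (le_trans (ltW re))//; case/andP: e01.
  by rewrite leNgt re.
have [ge _] := gC e e01.
have Ne : ~ N (gamma e).
  move=> Ne; have : \near e, N (gamma e) by apply: ge; apply: open_nbhs_nbhs.
  move=> /nbhs_ballP[d /= d0 Hd].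
  have [r Zr] := inf_adherent d0 Zinf; have er : e <= r by apply: ge_inf; [exact: Zinf.2|].
  move=> rd; apply: Zr.2; apply: Hd; rewrite -ball_normE/= distrC ger0_norm ?subr_ge0//.
  by rewrite ltrBlDr addrC.
(* Before time [e] the curve lies in the compact set [F], itself inside [N]. *)
pose F := chart_inv c @` [set u | qnorm G (u - u0) <= a + 2 * l].
have Fcl : closed F.
  apply: chart_inv_closed; first exact: qnorm_closed_ball_compact.
  by move=> u /= ul; have [] := gs u (le_lt_trans ul als).
have N0 : N (gamma 0).
  by split=> //; apply: le_lt_trans als; rewrite lerDl mulr_ge0.
have epos : 0 < e by rewrite lt_def e0 andbT; apply/eqP => eE; apply: Ne; rewrite eE.
have inF r : 0 <= r < e -> F (gamma r).
  move=> /andP[r0 re]; have [cr _] : N (gamma r) by apply: before; rewrite r0.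
  exists (chart_map c (gamma r)); last exact: chart_mapK.
  apply: le_trans (qnorm_triangle _ (chart_map c (gamma 0)) _ Gs) _.
  rewrite addrC lerD2l; apply: incr.
    by rewrite r0 (le_trans (ltW re))//; case/andP: e01.
  by move=> q /andP[q0 qr]; apply: before; rewrite q0 (le_lt_trans qr).
apply: Ne; suff [u ul <-] : F (gamma e).
  have us := le_lt_trans ul als; have [cu _] := gs u us.
  by split; [exact: chart_inv_dom|rewrite chart_invK].
apply: contrapT => NF.
have : \near e, (~` F) (gamma e).
  by apply: ge; apply: open_nbhs_nbhs; split=> //; exact: closed_openC.
move=> /nbhs_ballP[d /= d0 Hd].
pose r := Num.max 0 (e - d / 2).
have r_e : 0 <= r < e by rewrite /r le_max lexx/= gt_max epos/= ltrBlDr ltrDl divr_gt0.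
apply: (Hd r _ (inF r r_e)).
have : e - r <= d / 2 by rewrite lerBlDr -lerBlDl le_max lexx orbT.
rewrite -ball_normE/= ger0_norm; last by rewrite subr_ge0 ltW//; case/andP: r_e.
by move=> H; apply: le_lt_trans H _; rewrite ltr_pdivrMr// ltr_pMr// ltr1n.
Qed.

(** The distance budget [l] is spent piece by piece, each piece starting
    where the previous one was shown to remain. *)
Lemma path_stays c u0 (s l : R) x y L : good_radius c u0 s ->
  piecewise_C1_path g x y L -> (L <= l%:E)%E -> chart_dom c x ->
  qnorm (gram g c u0) (chart_map c x - u0) + 2 * l < s ->
  chart_dom c y /\ qnorm (gram g c u0) (chart_map c y - chart_map c x) <= 2 * l.
Proof.
move=> gs xy; elim: xy l => [{}x|gamma z k gC zk IH] l.
  by rewrite lee_fin => l0 cx _; rewrite subrr qnorm0 mulr_ge0.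
have k0 := path_length_ge0 zk; have L0 := curve_length_ge0 gamma.
case E1 : (curve_length g gamma) L0 => [l1| |]//; case E2 : k k0 zk => [l2| |]//.
rewrite !lee_fin => l20 zk l10 ll cx als.
have G0 := qnorm_ge0 (gram g c u0) (chart_map c (gamma 0) - u0).
have Gs : spd (gram g c u0).
  apply/gram_spd/(@qnorm_ball_center c u0 s) => //.
  by apply: le_lt_trans als; rewrite addr_ge0// mulr_ge0//; apply: le_trans ll; rewrite addr_ge0.
have [c1 d1] : chart_dom c (gamma 1) /\ qnorm (gram g c u0)
    (chart_map c (gamma 1) - chart_map c (gamma 0)) <= 2 * l1.
  apply: (curve_stays gs gC cx E1); apply: le_lt_trans als.
  by rewrite lerD2l ler_pM2l//; apply: le_trans ll; rewrite lerDl.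
have T1 := qnorm_triangle (chart_map c (gamma 1)) (chart_map c (gamma 0)) u0 Gs.
have kl2 : (k <= l2%:E)%E by rewrite E2.
have al2 : qnorm (gram g c u0) (chart_map c (gamma 1) - u0) + 2 * l2 < s.
  by apply: le_lt_trans als; lra.
have [cz dz] := IH l2 kl2 c1 al2.
split=> //; have := qnorm_triangle (chart_map c z) (chart_map c (gamma 1))
  (chart_map c (gamma 0)) Gs.
by move: dz; lra.
Qed.

Lemma geodesic_ballP x (r : R) y :
  geodesic_ball g x r y <-> exists2 L, piecewise_C1_path g x y L & (L < r%:E)%E.
Proof.
split=> [/ereal_inf_lt[L xyL Lr]|[L xyL Lr]]; first by exists L.
by apply: le_lt_trans Lr; exact: ereal_inf_lbound.
Qed.

Lemma ball_stays c u0 (s r : R) x y : good_radius c u0 s ->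
  geodesic_ball g x r y -> chart_dom c x ->
  qnorm (gram g c u0) (chart_map c x - u0) + 2 * r < s ->
  chart_dom c y /\ qnorm (gram g c u0) (chart_map c y - chart_map c x) <= 2 * r.
Proof. by move=> gs /geodesic_ballP[L xyL /ltW Lr]; exact: path_stays gs xyL Lr. Qed.

Lemma C1_curve_line c u v : (forall t : R, 0 <= t <= 1 -> chart_cod c (u + t *: v)) ->
  C1_curve X (fun t => chart_inv c (u + t *: v)).
Proof.
move=> cl t t01; have ct := cl t t01; pose line (s : R) := u + s *: v.
have lineD (s : R) : is_derive s 1 line v.
  exact: is_derive_affine.
have linec (s : R) : {for s, continuous line}.
  by apply/differentiable_continuous/derivable1_diffP; case: (lineD s).
split; first by apply: (continuous_comp (linec t)); exact: chart_inv_continuous.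
move=> c' c't; set T := chart_map c' \o chart_inv c.
have dT : (chart_map c @` (chart_dom c `&` chart_dom c')) (line t).
  by exists (chart_inv c (line t)); [split=> //; exact: chart_inv_dom|exact: chart_invK].
have nearT : \near t, (chart_map c @` (chart_dom c `&` chart_dom c')) (line t).
  by apply: linec; apply: open_nbhs_nbhs; split=> //; exact: transition_open.
have TD s : (chart_map c @` (chart_dom c `&` chart_dom c')) (line s) ->
    is_derive s 1 (T \o line) (\sum_i v 0 i *: partial i T (line s)).
  move=> [x [cx c'x] xl]; have Tx : differentiable T (line s).
    by rewrite -xl; exact: transition_differentiable.
  have [lD lE] := lineD s; move/derivable1_diffP: (lD) => lD'.
  split; first by apply/derivable1_diffP; exact: differentiable_comp.
  rewrite deriveE; last exact: differentiable_comp.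
  rewrite diff_comp//= -(deriveE (1 : R) lD') lE -deriveE//.
  exact: derive_sum_partial.
split; first by apply: filterS nearT => s /TD[].
apply: (@near_eq_continuous_at _ _ (fun s => \sum_i v 0 i *: partial i T (line s))).
  by apply: filterS nearT => s /TD[_ ->].
apply: continuous_at_sum => i; apply: cvgZl_tmp.
apply: (continuous_comp (linec t)).
have [_ /(_ i)[_ [piC _]]] := @transition_smooth _ _ _ X c c' 1.
exact: piC dT.
Qed.

(** The segment joining the two points in the chart is an admissible curve, of
    length at most twice its length for the fixed form. *)
Lemma ball_chart_line c u0 (s r : R) u v : good_radius c u0 s ->
  qnorm (gram g c u0) (u - u0) < s -> qnorm (gram g c u0) (v - u0) < s ->
  2 * qnorm (gram g c u0) (v - u) < r ->
  geodesic_ball g (chart_inv c u) r (chart_inv c v).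
Proof.
move=> gs us vs vr; set G := gram g c u0.
have Gs : spd G.
  by apply/gram_spd/(@qnorm_ball_center c u0 s) => //; apply: le_lt_trans us; exact: qnorm_ge0.
have ls t : 0 <= t <= 1 -> qnorm G (u + t *: (v - u) - u0) < s.
  move=> /andP[t0 t1].
  have -> : u + t *: (v - u) - u0 = (1 - t) *: (u - u0) + t *: (v - u0).
    by apply/rowP => i; rewrite !mxE; ring.
  apply: le_lt_trans (qnormD _ _ Gs) _.
  rewrite !qnormZ !ger0_norm ?subr_ge0//.
  have [->|tn0] := eqVneq t 0; first by rewrite subr0 mul1r mul0r addr0.
  have tp : 0 < t by rewrite lt_def tn0.
  apply: (@lt_le_trans _ _ ((1 - t) * s + t * s)); last by rewrite -mulrDl subrK mul1r.
  by apply: ler_ltD; rewrite ?ltr_pM2l// ler_wpM2l ?subr_ge0// ltW.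
have gC := C1_curve_line (fun t t01 => (gs _ (ls t t01)).1).
set gamma := (fun t => _) in gC.
have gammaE0 : gamma 0 = chart_inv c u by rewrite /gamma scale0r addr0.
have gammaE1 : gamma 1 = chart_inv c v by rewrite /gamma scale1r addrC subrK.
have len : (curve_length g gamma <= (2 * qnorm G (v - u))%:E)%E.
  apply: le_trans (_ : _ <= \int[lebesgue_measure]_(t in `[0%R, 1%R])
      (cst (2 * qnorm G (v - u))%:E t))%E _; last first.
    by rewrite integral_cst//= lebesgue_measure_itv/= lte_fin ltr01 oppr0 adde0 mule1.
  apply: ge0_le_integral_any => [t _|t]; first by rewrite lee_fin tnormE qnorm_ge0.
  rewrite /= in_itv/= => t01; have [ct Gt] := gs _ (ls t t01).
  rewrite lee_fin (@C1_curve_tnorm _ _ _ _ g c gamma t gC t01 (chart_inv_dom ct)).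
  rewrite /gamma chart_invK//.
  rewrite (_ : 'D_1 _ t = v - u); first by have [] := Gt (v - u).
  have near_line : \near t, u + t *: (v - u) =
      (chart_map c \o (fun t => chart_inv c (u + t *: (v - u)))) t.
    have : \near t, chart_cod c (u + t *: (v - u)).
      have lc : {for t, continuous (fun t : R => u + t *: (v - u))}.
        by apply: cvgD; [exact: cvg_cst|apply: cvgZr_tmp; exact: cvg_id].
      by apply: lc; exact: chart_cod_nbhs.
    by apply: filterS => r' cr'; rewrite /= chart_invK.
  rewrite -(near_eq_derive _ near_line).
  exact: (@derive_val _ _ _ _ _ _ _ (is_derive_affine u (v - u) t)).
apply/geodesic_ballP; exists (curve_length g gamma + 0)%E.
  rewrite -gammaE0; apply: (@path_cons _ _ _ _ g gamma (chart_inv c v) 0%E gC).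
  by rewrite gammaE1; exact: path_nil.
by rewrite adde0; apply: le_lt_trans len _; rewrite lte_fin.
Qed.

End LocalComparison.

(** * The distance and its topology *)

Section MetricTopology.
Context (R : realType) (n : nat) (M : topologicalType).
Context (X : smooth_manifold R n M) (g : riemannian_metric X).
Implicit Types (c : chart X) (x y z : M) (u v : 'rV[R]_n) (gamma : R -> M).

Lemma is_derive_onem (f : R -> 'rV[R]_n) (t : R) : derivable f (1 - t) 1 ->
  is_derive t 1 (fun s : R => f (1 - s)) (- 'D_1 f (1 - t)).
Proof.
move=> fD; have fD' : differentiable f (1 - t) by exact/derivable1_diffP.
have oD : is_derive t 1 (fun s : R => 1 - s) (-1 : R).
  apply: (is_derive_eq (is_deriveB (is_derive_cst (1 : R) t 1) (is_derive_id t 1))).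
  by rewrite sub0r.
have oD' : differentiable (fun s : R => 1 - s) t.
  by apply/derivable1_diffP; case: oD.
split; first by apply/derivable1_diffP; exact: (differentiable_comp oD' fD').
rewrite deriveE; last exact: (differentiable_comp oD' fD').
rewrite (@diff_comp _ _ _ _ (fun s : R => 1 - s) f t oD' fD') /= -(deriveE (1 : R) oD').
by rewrite (@derive_val _ _ _ _ _ _ _ oD) linearN -deriveE.
Qed.

Lemma near_onem (P : R -> Prop) (t : R) :
  (\forall s \near (1 - t), P s) -> \forall s \near t, P (1 - s).
Proof.
move=> /nbhs_ballP[e /= e0 He]; apply/nbhs_ballP; exists e => // s ts.
apply: He; move: ts; rewrite -!ball_normE /= distrC.
by rewrite (_ : 1 - t - (1 - s) = s - t); last by ring.
Qed.

Lemma C1_curve_rev gamma : C1_curve X gamma -> C1_curve X (fun t => gamma (1 - t)).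
Proof.
move=> gC t /andP[t0 t1].
have t01 : 0 <= 1 - t <= 1 by rewrite subr_ge0 t1 lerBlDr lerDl t0.
have oc : {for t, continuous (fun s : R => 1 - s)}.
  by apply: cvgB; [exact: cvg_cst|exact: cvg_id].
have [gc gD] := gC _ t01; split; first exact: (continuous_comp oc gc).
move=> c ct; have [Dn Dc] := gD c ct.
have {}Dn := near_onem Dn.
split.
  by apply: filterS Dn => s /= /is_derive_onem[].
apply: (@near_eq_continuous_at R 'rV[R]_n (fun s : R => - 'D_1 (chart_map c \o gamma) (1 - s))).
  by apply: filterS Dn => s /= /is_derive_onem[_ ->].
by apply: cvgN; exact: (continuous_comp oc Dc).
Qed.

Lemma tnorm_velocity_rev gamma (t : R) : C1_curve X gamma -> 0 <= 1 - t <= 1 ->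
  tnorm g (velocity X (fun s => gamma (1 - s)) t) = tnorm g (velocity X gamma (1 - t)).
Proof.
move=> gC t01; set x := gamma (1 - t).
have fD := C1_curve_derivable gC t01 (chart_at_dom X x).
have [_ fE] := is_derive_onem fD.
transitivity (qnorm (gram_at g x) (- 'D_1 (chart_map (chart_at X x) \o gamma) (1 - t))).
  by rewrite -fE.
by rewrite qnormN.
Qed.

Lemma curve_length_rev gamma : C1_curve X gamma ->
  curve_length g (fun t => gamma (1 - t)) = curve_length g gamma.
Proof.
move=> gC; rewrite /curve_length.
have h01 : (0 <= 1 :> R) && (1 <= 1 :> R) by rewrite ler01 lexx.
rewrite [RHS](integration_by_substitution_onem h01 (@speed_continuous _ _ _ _ g gamma gC)).
rewrite (_ : unstable.onem 1 = 0); last by rewrite /unstable.onem subrr.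
apply: eq_integral => t; rewrite inE/= in_itv/= => /andP[t0 t1].
have t01 : 0 <= 1 - t <= 1 by rewrite subr_ge0 t1 lerBlDr lerDl t0.
by rewrite tnorm_velocity_rev.
Qed.

Lemma path_cat x y z L1 L2 : piecewise_C1_path g x y L1 ->
  piecewise_C1_path g y z L2 -> piecewise_C1_path g x z (L1 + L2)%E.
Proof.
elim=> [x'|gamma y' l gC yl IH] yz; first by rewrite add0e.
by rewrite -addeA; apply: path_cons => //; exact: IH.
Qed.

Lemma path_rev x y L : piecewise_C1_path g x y L -> piecewise_C1_path g y x L.
Proof.
elim=> [x'|gamma y' l gC yl IH]; first exact: path_nil.
rewrite addeC; apply: (path_cat IH).
have := @path_cons _ _ _ _ g (fun t => gamma (1 - t)) (gamma 0) 0%E (C1_curve_rev gC).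
by rewrite subr0 subrr adde0 curve_length_rev//; apply; exact: path_nil.
Qed.

Lemma geodesic_ball_sym x (r : R) y : geodesic_ball g x r y -> geodesic_ball g y r x.
Proof. by move=> /geodesic_ballP[L /path_rev yx Lr]; apply/geodesic_ballP; exists L. Qed.

Lemma geodesic_ball_trans x (r s : R) y z :
  geodesic_ball g x r y -> geodesic_ball g y s z -> geodesic_ball g x (r + s) z.
Proof.
move=> /geodesic_ballP[L xy Lr] /geodesic_ballP[K yz Ks].
apply/geodesic_ballP; exists (L + K)%E; first exact: path_cat yz.
by rewrite EFinD lteD.
Qed.

Lemma geodesic_ball_center x (r : R) : 0 < r -> geodesic_ball g x r x.
Proof. by move=> r0; apply/geodesic_ballP; exists 0%E; [exact: path_nil|rewrite lte_fin]. Qed.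

Lemma geodesic_ball_le x (r s : R) : r <= s -> geodesic_ball g x r `<=` geodesic_ball g x s.
Proof. by move=> rs y /lt_le_trans; apply; rewrite lee_fin. Qed.

(** With [nbhs_geodesic_ball_sub], this says that the distance induces the
    topology of the manifold: balls are neighborhoods because segments in charts
    are short, and they are small because short curves stay in charts. *)
Lemma nbhs_geodesic_ball x (r : R) : 0 < r -> nbhs x (geodesic_ball g x r).
Proof.
move=> r0; pose c := chart_at X x; have cx : chart_dom c x by exact: chart_at_dom.
have [s s0 gs] := exists_good_radius g (chart_map_cod cx).
set u0 := chart_map c x in gs *; set G := gram g c u0.
have Gs : spd G by apply/gram_spd/chart_map_cod.
pose U := [set u | qnorm G (u - u0) < Num.min s (r / 2)].
have m0 : 0 < Num.min s (r / 2) by rewrite lt_min s0 divr_gt0.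
have Uc : U `<=` chart_cod c by move=> u; rewrite /U /= lt_min => /andP[/gs[]].
have oU : open (chart_inv c @` U) by apply: chart_inv_open => //; exact: qnorm_ball_open.
apply: filterS (open_nbhs_nbhs (conj oU _)).
  move=> _ [u /= + <-]; rewrite /U /= lt_min => /andP[us ur].
  rewrite -(chart_mapK cx); apply: (ball_chart_line gs) => //.
    by rewrite subrr qnorm0.
  by rewrite mulrC -ltr_pdivlMr.
by exists u0; [rewrite /U /= subrr qnorm0|exact: chart_mapK].
Qed.

Lemma geodesic_ball_open x (r : R) : open (geodesic_ball g x r).
Proof.
rewrite openE => y /geodesic_ballP[L xy Lr]; rewrite /interior.
have := path_length_ge0 xy; case: L xy Lr => [l| |]//; rewrite lte_fin => xy lr l0.
have d0 : 0 < (r - l) / 2 by rewrite divr_gt0// subr_gt0.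
apply: filterS (nbhs_geodesic_ball y d0) => z yz.
have xy' : geodesic_ball g x (l + (r - l) / 2) y.
  by apply/geodesic_ballP; exists l%:E => //; rewrite lte_fin ltrDl.
have := geodesic_ball_trans xy' yz; apply: geodesic_ball_le.
by rewrite -addrA -splitr addrC subrK.
Qed.

Lemma nbhs_geodesic_ball_sub x (A : set M) : nbhs x A ->
  exists2 r : R, 0 < r & geodesic_ball g x r `<=` A.
Proof.
move=> xA; pose c := chart_at X x; have cx : chart_dom c x by exact: chart_at_dom.
have cu := chart_map_cod cx; have [s s0 gs] := exists_good_radius g cu.
have [k k0 Hk] := norm_le_qnorm (gram_spd g cu).
have : nbhs (chart_map c x) (chart_inv c @^-1` A).
  by apply: (chart_inv_continuous cu); rewrite chart_mapK.
move=> /nbhs_ballP[e /= e0 eA].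
exists (Num.min (s / 4) (k * e / 4)); first by rewrite lt_min !divr_gt0// mulr_gt0.
move=> y xy; set r := Num.min _ _ in xy.
have rs : 2 * r < s.
  have : r <= s / 4 by rewrite /r ge_min lexx.
  by move: s0; lra.
have rk : 2 * r < k * e.
  have : r <= k * e / 4 by rewrite /r ge_min lexx orbT.
  have : 0 < k * e by rewrite mulr_gt0.
  by lra.
have xs : qnorm (gram g c (chart_map c x)) (chart_map c x - chart_map c x) + 2 * r < s.
  by rewrite subrr qnorm0 add0r.
have [cy dy] := ball_stays gs xy cx xs.
rewrite -(chart_mapK cy); apply: eA; rewrite -ball_normE /= distrC -(ltr_pM2l k0).
by apply: le_lt_trans (Hk _) _; apply: le_lt_trans rk.
Qed.

End MetricTopology.

(** * Volumes of balls *)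

Section BorelSets.
Context (T : ptopologicalType).

Lemma measurable_borel_open (A : set T) : open A -> measurable (A : set (borel T)).
Proof. by move=> oA; exact: sub_gen_smallest. Qed.

Lemma measurable_borel_closed (A : set T) : closed A -> measurable (A : set (borel T)).
Proof.
move=> cA; rewrite -[A]setCK; apply: (@measurableC _ (borel T)).
by apply: (@measurable_borel_open (~` A)); exact: closed_openC.
Qed.

End BorelSets.

Lemma exists_ge_pow2 (R : realType) (a b : R) : 0 < b -> exists k : nat, a <= 2 ^+ k * b.
Proof.
move=> b0; exists (Num.bound (a / b)); rewrite -ler_pdivrMr//.
have [ab0|/ltW ab0] := leP (a / b) 0.
  by apply: (le_trans ab0); rewrite exprn_ge0.
apply: ltW; apply: lt_le_trans (archi_boundP ab0) _.
by rewrite -natrX ler_nat; apply: ltnW; exact: ltn_expl.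
Qed.

Lemma continuous_at_prod (R : realType) (T : topologicalType) (I : Type) (r : seq I)
    (F : I -> T -> R^o) (x : T) : (forall i, {for x, continuous (F i)}) ->
  {for x, continuous (fun y => \prod_(i <- r) F i y : R^o)}.
Proof.
move=> Fc; elim: r => [|i r IHr]; rewrite /prop_for /continuous_at.
  by under eq_cvg do rewrite big_nil; rewrite big_nil; exact: cvg_cst.
under eq_cvg do rewrite big_cons; rewrite big_cons.
exact: cvgM (Fc i) IHr.
Qed.

Section Volume.
Context (R : realType) (n : nat) (M : ptopologicalType).
Context (X : smooth_manifold R n M) (g : riemannian_metric X).
Context (leb : {measure set (borel 'rV[R]_n) -> \bar R}).
Context (vol : {measure set (borel M) -> \bar R}).
Hypotheses (hleb : is_lebesgue leb) (hvol : is_riemannian_volume g leb vol).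
Implicit Types (c : chart X) (x y z : M) (u v : 'rV[R]_n).

Lemma measurable_ball x (r : R) : measurable (geodesic_ball g x r : set (borel M)).
Proof. by apply: measurable_borel_open; exact: geodesic_ball_open. Qed.

Lemma det_gram_continuous c u : chart_cod c u ->
  {for u, continuous (fun v => \det (gram g c v) : R^o)}.
Proof.
move=> cu; rewrite /determinant; apply: (@continuous_at_sum _ _ R^o) => s.
have P : {for u, continuous (fun v : 'rV[R]_n =>
    \prod_i gram g c v i (perm.fun_of_perm s i) : R^o)}.
  apply: (@continuous_at_prod R 'rV[R]_n 'I_n (index_enum 'I_n)
    (fun i v => gram g c v i (perm.fun_of_perm s i)) u) => i.
  exact: gram_continuous.
exact: (cvgM (cvg_cst _) P).
Qed.

(** A small coordinate cube works: its Lebesgue measure is known, and the density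
    [Num.sqrt (\det gram)] is continuous and positive, hence pinched between two
    positive constants on it. *)
Lemma exists_compact_nbhs x (A : set M) : nbhs x A ->
  exists C : set M, [/\ C `<=` A, measurable (C : set (borel M)), nbhs x C &
    (0 < vol C < +oo)%E].
Proof.
move=> xA; pose c := chart_at X x; have cx : chart_dom c x by exact: chart_at_dom.
have cu := chart_map_cod cx; set u0 := chart_map c x in cu.
pose j u := Num.sqrt (\det (gram g c u)).
have j0 : 0 < j u0 by rewrite sqrtr_gt0; apply: spd_det_gt0; exact: gram_spd.
have jc : {for u0, continuous (j : _ -> R^o)}.
  exact: (continuous_comp (det_gram_continuous cu) (@sqrt_continuous _ _)).
have xA' : nbhs u0 (chart_inv c @^-1` A).
  by apply: (chart_inv_continuous cu); rewrite chart_mapK.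
have j20 : 0 < j u0 / 2 by exact: divr_gt0.
have : \forall u \near u0, [/\ chart_cod c u, A (chart_inv c u) & `|j u0 - j u| <= j u0 / 2].
  have /cvgrPdist_le/(_ _ j20) J := jc.
  near=> u; split; [near: u; exact: chart_cod_nbhs|near: u; exact: xA'|near: u; exact: J].
move=> /nbhs_ballP[r /= r0 Hr].
pose d := r / 2; have d0 : 0 < d by exact: divr_gt0.
pose Q := [set u : 'rV[R]_n | forall i, u0 0 i - d <= u 0 i <= u0 0 i + d].
have QE : Q = [set u | forall i, [set` `[u0 0 i - d, u0 0 i + d]] (u ord0 i)].
  by apply/seteqP; split=> u /= Qu i; have := Qu i; rewrite ?in_itv /= ?in_itv.
have cQ : compact Q.
  by rewrite QE; apply: (@rV_compact _ _ (fun i => [set` `[u0 0 i - d, u0 0 i + d]])) => i;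
    exact: segment_compact.
have Qr : Q `<=` ball u0 r.
  move=> u Qu; rewrite -ball_normE /=; apply: le_lt_trans (_ : d < r); last first.
    by rewrite /d; move: r0; lra.
  apply: ler_rVnorm; first exact: ltW.
  by move=> i; have /andP[h1 h2] := Qu i; rewrite !mxE ler_norml; apply/andP; split; lra.
have Qc : Q `<=` chart_cod c by move=> u /Qr/Hr[].
have mQ : measurable (Q : set (borel 'rV[R]_n)).
  by apply: measurable_borel_closed; apply: compact_closed => //; exact: norm_hausdorff.
have lebQ : leb Q = ((2 * d) ^+ n)%:E.
  pose a : 'rV[R]_n := \row_i (u0 0 i - d); pose b : 'rV[R]_n := \row_i (u0 0 i + d).
  have -> : Q = [set u | forall i, a 0 i <= u 0 i <= b 0 i].
    by apply/seteqP; split=> u Qu i; have := Qu i; rewrite !mxE.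
  rewrite hleb; last by move=> i; rewrite !mxE lerBlDr -addrA lerDl addr_ge0 ?ltW.
  rewrite (eq_bigr (fun=> 2 * d)) ?prodr_const ?card_ord// => i _.
  by rewrite !mxE; ring.
have q0 : 0 < (2 * d) ^+ n by rewrite exprn_gt0// mulr_gt0.
have cC : closed (chart_inv c @` Q) by exact: chart_inv_closed.
have CE : chart_map c @` (chart_inv c @` Q) = Q.
  apply/seteqP; split=> [_ [_ [u Qu <-] <-]|u Qu]; first by rewrite chart_invK//; exact: Qc.
  by exists (chart_inv c u); [exists u|rewrite chart_invK//; exact: Qc].
exists (chart_inv c @` Q); split.
- by move=> _ [u /Qr/Hr[_ Au _] <-].
- exact: measurable_borel_closed.
- have oB : open (ball u0 d) by exact: ball_open.
  have BQ : ball u0 d `<=` Q.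
    move=> u; rewrite -ball_normE /= => ud i.
    have := le_lt_trans (ler_coord_norm (u0 - u) i) ud.
    by rewrite !mxE ltr_norml => /andP[h1 h2]; apply/andP; split; lra.
  have oI : open (chart_inv c @` ball u0 d).
    by apply: chart_inv_open => // u /BQ; exact: Qc.
  apply: filterS (open_nbhs_nbhs (conj oI _)); first exact: image_subset.
  by exists u0; [exact: ballxx|exact: chart_mapK].
- rewrite (hvol (c := c)); last first.
  + by move=> _ [u Qu <-]; apply: chart_inv_dom; exact: Qc.
  + exact: measurable_borel_closed.
  rewrite CE; have jQ u : Q u -> j u0 / 2 <= j u <= 2 * j u0.
    move=> /Qr/Hr[_ _]; rewrite ler_norml => /andP[h1 h2].
    by apply/andP; split; move: j0; lra.
  have cst_int k : (\int[leb]_(u in Q) (cst k%:E u))%E = (k * (2 * d) ^+ n)%:E.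
    by rewrite integral_cst// lebQ EFinM.
  apply/andP; split.
  + apply: (@lt_le_trans _ _ (\int[leb]_(u in Q) (cst (j u0 / 2)%:E u))%E).
      by rewrite cst_int lte_fin mulr_gt0.
    apply: ge0_le_integral_any => u Qu; rewrite /= lee_fin; first exact: ltW.
    by have /andP[] := jQ u Qu.
  + apply: (@le_lt_trans _ _ (\int[leb]_(u in Q) (cst (2 * j u0)%:E u))%E).
      apply: ge0_le_integral_any => u Qu; rewrite /= lee_fin; first exact: sqrtr_ge0.
      by have /andP[] := jQ u Qu.
    by rewrite cst_int ltry.
Unshelve. all: by end_near. Qed.

Lemma vol_open_gt0 (A : set M) x : open A -> A x -> (0 < vol A)%E.
Proof.
move=> oA Ax; have [C [CA mC _ /andP[C0 _]]] := exists_compact_nbhs (open_nbhs_nbhs (conj oA Ax)).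
apply: lt_le_trans C0 _; apply: le_measure => //; rewrite inE//.
exact: measurable_borel_open.
Qed.

Lemma vol_ball_gt0 x (r : R) : 0 < r -> (0 < vol (geodesic_ball g x r))%E.
Proof.
move=> r0; apply: (@vol_open_gt0 _ x); first exact: geodesic_ball_open.
exact: geodesic_ball_center.
Qed.

Section Doubling.
Variable D : R.
Hypothesis D0 : 0 < D.
Hypothesis doubling : forall (r : R) x, 0 < r ->
  (vol (geodesic_ball g x (2 * r)) <= D%:E * vol (geodesic_ball g x r))%E.

Lemma vol_ball_pow2 x (r : R) k : 0 < r ->
  (vol (geodesic_ball g x (2 ^+ k * r)) <= (D ^+ k)%:E * vol (geodesic_ball g x r))%E.
Proof.
move=> r0; elim: k => [|k IHk]; first by rewrite !expr0 mul1r mul1e.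
rewrite exprS -mulrA; apply: le_trans (doubling _ _) _.
  by rewrite mulr_gt0// exprn_gt0.
rewrite exprS EFinM -muleA; apply: lee_wpmul2l => //.
by rewrite lee_fin ltW.
Qed.

Lemma vol_ball_fin x (r : R) : (vol (geodesic_ball g x r) < +oo)%E.
Proof.
have [C [_ mC xC /andP[_ Coo]]] := exists_compact_nbhs (@filterT _ _ (nbhs_filter x)).
have [s s0 sC] := nbhs_geodesic_ball_sub g xC.
have [k rk] := exists_ge_pow2 r s0.
have sfin : (vol (geodesic_ball g x s) < +oo)%E.
  by apply: le_lt_trans Coo; apply: le_measure => //; rewrite inE//; exact: measurable_ball.
apply: le_lt_trans (_ : vol (geodesic_ball g x (2 ^+ k * s)) < +oo)%E.
  apply: le_measure; rewrite ?inE; try exact: measurable_ball.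
  exact: geodesic_ball_le.
apply: le_lt_trans (vol_ball_pow2 _ _ s0) _.
by rewrite lte_mul_pinfty// lee_fin exprn_ge0// ltW.
Qed.

Lemma vol_ball_fin_num x (r : R) : vol (geodesic_ball g x r) \is a fin_num.
Proof. by rewrite ge0_fin_numE ?vol_ball_fin. Qed.

(** A separated family has disjoint half-size balls, all of comparable volume:
    its cardinality is bounded independently of the scale. *)
Lemma packing x (r e : R) k (N : nat) (p : 'I_N -> M) : 0 < r -> 0 < e ->
  2 * r + e <= 2 ^+ k * (e / 2) ->
  (forall i, geodesic_ball g x r (p i)) ->
  (forall i j, i != j -> ~ geodesic_ball g (p i) e (p j)) ->
  N%:R <= D ^+ k.
Proof.
move=> r0 e0 rek px psep; have e20 : 0 < e / 2 by exact: divr_gt0.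
pose B i := geodesic_ball g (p i) (e / 2); pose V := geodesic_ball g x (r + e / 2).
have V0 : 0 < fine (vol V).
  by apply: fine_gt0; rewrite vol_ball_gt0 ?vol_ball_fin// addr_gt0.
have VB i : fine (vol V) <= D ^+ k * fine (vol (B i)).
  rewrite -lee_fin EFinM !fineK ?vol_ball_fin_num//.
  apply: le_trans (vol_ball_pow2 _ _ e20).
  apply: le_measure; rewrite ?inE; try exact: measurable_ball.
  move=> y Vy; have := geodesic_ball_trans (geodesic_ball_sym (px i)) Vy.
  by apply: geodesic_ball_le; apply: le_trans rek; lra.
have tB : trivIset setT B.
  apply/trivIsetP => i j _ _ ij; rewrite -subset0 => y [Bi Bj].
  apply: (psep i j ij); have := geodesic_ball_trans Bi (geodesic_ball_sym Bj).
  by rewrite -splitr.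
have SB : \sum_(i < N) fine (vol (B i)) <= fine (vol V).
  rewrite -lee_fin fineK ?vol_ball_fin_num// -sumEFin.
  rewrite (eq_bigr (fun i => vol (B i))); last by move=> i _; rewrite fineK ?vol_ball_fin_num.
  rewrite -measure_semi_additive_ord//; last 2 first.
  - by move=> i; exact: measurable_ball.
  - by apply: bigsetU_measurable => i _; exact: measurable_ball.
  apply: le_measure; rewrite ?inE; try exact: measurable_ball.
    by apply: bigsetU_measurable => i _; exact: measurable_ball.
  apply: (@big_ind _ (fun A : set M => A `<=` V)) => [//|A B' AV BV|i _ y Biy].
    by rewrite subUset.
  exact: geodesic_ball_trans (px _) Biy.
rewrite -(ler_pM2r V0); apply: (@le_trans _ _ (D ^+ k * \sum_(i < N) fine (vol (B i)))); last first.
  by rewrite ler_wpM2l// exprn_ge0// ltW.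
rewrite mulr_sumr -[X in X%:R]card_ord mulr_natl -sumr_const.
by apply: ler_sum => i _; exact: VB.
Qed.

(** A separated family of maximal cardinality exists by [packing], and a point
    left uncovered could be added to it. *)
Lemma exists_net (P : set M) x (r e : R) : 0 < r -> 0 < e ->
  P `<=` geodesic_ball g x r ->
  exists (N : nat) (p : 'I_N -> M), [/\ forall i, P (p i),
    forall i j, i != j -> ~ geodesic_ball g (p i) e (p j) &
    forall y, P y -> exists i, geodesic_ball g (p i) e y].
Proof.
move=> r0 e0 Pr; pose sep N := exists p : 'I_N -> M, (forall i, P (p i)) /\
  forall i j, i != j -> ~ geodesic_ball g (p i) e (p j).
have [k rek] := exists_ge_pow2 (2 * r + e) (divr_gt0 e0 (ltr0n R 2)).
have Dk0 : 0 <= D ^+ k by rewrite exprn_ge0// ltW.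
have sep_bound N : `[< sep N >] -> (N <= Num.bound (D ^+ k))%N.
  move=> /asboolP[p [pP psep]].
  have := packing r0 e0 rek (fun i => Pr _ (pP i)) psep.
  by move=> /le_lt_trans/(_ (archi_boundP Dk0)); rewrite ltr_nat => /ltnW.
have sep0 : exists N, `[< sep N >].
  by exists 0; apply/asboolP; exists (fun=> x); split=> -[].
case: (ex_maxnP sep0 sep_bound) => N /asboolP[p [pP psep]] Nmax.
exists N, p; split=> // y Py; apply: contrapT => ny.
suff /Nmax : `[< sep N.+1 >] by rewrite ltnn.
apply/asboolP; exists (fun i => if unlift ord0 i is Some j then p j else y).
split=> [i|i j]; first by case: unliftP.
case: unliftP => [i' ->|->]; case: unliftP => [j' ->|->].
- by rewrite (inj_eq lift_inj); exact: psep.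
- by move=> _ pi; apply: ny; exists i'.
- by move=> _ pj; apply: ny; exists j'; exact: geodesic_ball_sym.
- by rewrite eqxx.
Qed.

End Doubling.
End Volume.

(** * Bounded closed sets are compact *)

Lemma ultrafilter_finite_cover (T : Type) (I : finType) (A : I -> set T)
    (F : set_system T) : UltraFilter F -> F [set y | exists i, A i y] -> exists i, F (A i).
Proof.
move=> UF FA; apply: contrapT => nF.
have FC : \forall y \near F, forall i, (~` A i) y.
  apply: filter_forall => i; have [FAi|//] := in_ultra_setVsetC (A i) UF.
  by case: nF; exists i.
by have [y [[i Ai] /(_ i)]] := filter_ex (filterI FA FC).
Qed.

Section Properness.
Context (R : realType) (n : nat) (M : ptopologicalType).
Context (X : smooth_manifold R n M) (g : riemannian_metric X).
Context (leb : {measure set (borel 'rV[R]_n) -> \bar R}).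
Context (vol : {measure set (borel M) -> \bar R}).
Hypotheses (hleb : is_lebesgue leb) (hvol : is_riemannian_volume g leb vol).
Variable D : R.
Hypothesis D0 : 0 < D.
Hypothesis doubling : forall (r : R) (x : M), 0 < r ->
  (vol (geodesic_ball g x (2 * r)) <= D%:E * vol (geodesic_ball g x r))%E.
Hypothesis hcomplete : complete_manifold g.

(** Packing makes balls totally bounded, so an ultrafilter containing a ball
    contains balls of every radius; their centers form a Cauchy sequence. *)
Lemma bounded_ultrafilter_cvg (F : set_system M) x (r : R) : UltraFilter F ->
  F (geodesic_ball g x r) -> exists y : M, F --> y.
Proof.
move=> UF Fx.
have [r0|r0] := ltP 0 r; last first.
  have [y xy] := filter_ex Fx.
  have /geodesic_ballP[L /path_length_ge0 L0 Lr] := xy.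
  by have := le_lt_trans L0 Lr; rewrite lte_fin ltNge r0.
have small (m : nat) : exists y, F (geodesic_ball g y m.+1%:R^-1).
  have m0 : 0 < m.+1%:R^-1 :> R by rewrite invr_gt0 ltr0n.
  have id_sub : geodesic_ball g x r `<=` geodesic_ball g x r by [].
  have [N [p [_ _ pcov]]] := exists_net hleb hvol D0 doubling r0 m0 id_sub.
  have Fcov : F [set y | exists i, geodesic_ball g (p i) m.+1%:R^-1 y].
    by apply: filterS Fx; exact: pcov.
  have [i Fi] := @ultrafilter_finite_cover _ _
    (fun i => geodesic_ball g (p i) m.+1%:R^-1) F UF Fcov.
  by exists (p i).
have [u uF] := choice small.
have inv_small (e : R) : 0 < e -> exists N, forall m, (N <= m)%N -> m.+1%:R^-1 <= e / 2.
  move=> e0; exists (Num.bound (2 / e)) => m Nm.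
  have h : 0 <= 2 / e by rewrite divr_ge0 ?ltW.
  rewrite -[e / 2]invrK lef_pV2 ?posrE ?invr_gt0 ?divr_gt0 ?ltr0n// invf_div.
  apply: le_trans (ltW (archi_boundP h)) _.
  by rewrite ler_nat; apply: leq_trans Nm _.
have cauchy_u (e : R) : 0 < e -> exists N, forall p q, (N <= p)%N -> (N <= q)%N ->
    geodesic_ball g (u p) e (u q).
  move=> e0; have [N HN] := inv_small e e0; exists N => p q pN qN.
  have [z [pz qz]] := filter_ex (filterI (uF p) (uF q)).
  have := geodesic_ball_trans pz (geodesic_ball_sym qz).
  by apply: geodesic_ball_le; rewrite [leRHS]splitr lerD// HN.
have [y uy] := hcomplete cauchy_u.
exists y => A /(@nbhs_geodesic_ball_sub _ _ _ X g)[e e0 eA].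
have e20 : 0 < e / 2 by exact: divr_gt0.
have [N1 HN1] := uy _ e20; have [N2 HN2] := inv_small e e0.
pose m := maxn N1 N2.
apply: filterS (uF m) => z mz; apply: eA.
have ym : geodesic_ball g y (e / 2) (u m).
  by apply: geodesic_ball_sym; exact: HN1 (leq_maxl _ _).
have := geodesic_ball_trans ym mz; apply: geodesic_ball_le.
by rewrite [leRHS]splitr lerD2l HN2// leq_maxr.
Qed.

Lemma bounded_closed_compact_set (A : set M) x (r : R) : closed A ->
  A `<=` geodesic_ball g x r -> compact A.
Proof.
move=> cA Ar; rewrite compact_ultra => F UF FA.
have [y Fy] := bounded_ultrafilter_cvg UF (filterS Ar FA).
exists y; split=> //; apply: cA => B /Fy FB.
by have [z [Az Bz]] := filter_ex (filterI FA FB); exists z.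
Qed.

(** Otherwise every point would lie within [r] of [K], and enlarging by [r] a
    finite cover of [K] by unit balls would cover the whole space; every
    ultrafilter would then contain a ball and converge. *)
Lemma exists_ball_away (K : set M) (r : R) : ~ compact [set: M] -> compact K ->
  exists x, forall y, K y -> ~ geodesic_ball g x r y.
Proof.
move=> ncM cK; apply: contrapT => near_K; apply: ncM.
have hit x : exists2 y, K y & geodesic_ball g x r y.
  apply: contrapT => nx; apply: near_K; exists x => y Ky xy.
  by apply: nx; exists y.
have Ko y : K y -> open (geodesic_ball g y 1) by move=> _; exact: geodesic_ball_open.
have Kc : K `<=` cover K (fun y => geodesic_ball g y 1).
  by move=> y Ky; exists y => //; exact: geodesic_ball_center.
have cK' : cover_compact K by rewrite -compact_cover.
have [E _ KE] := cK' M K _ Ko Kc.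
rewrite compact_ultra => F UF _.
have Fcov : F [set x | exists i : finmap.fset_sub_type E,
    geodesic_ball g (finmap.fsval i) (1 + r) x].
  apply: filterS filterT => x _; have [y /KE[i /= iE iy] xy] := hit x.
  exists (finmap.FSetSub iE); apply: geodesic_ball_trans iy _.
  exact: geodesic_ball_sym.
have [i Fi] := @ultrafilter_finite_cover _ _
  (fun i : finmap.fset_sub_type E => geodesic_ball g (finmap.fsval i) (1 + r)) F UF Fcov.
by have [y Fy] := bounded_ultrafilter_cvg UF Fi; exists y.
Qed.

End Properness.

(** A property of scales that holds locally uniformly, for all small scales,
    holds uniformly on a compact set. *)
Lemma compact_uniform_scale (R : realType) (T : topologicalType) (K : set T)
    (P : R -> T -> Prop) : compact K ->
  (forall x, K x -> exists2 e : R, 0 < e &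
     \forall y \near x, forall d, 0 < d -> d <= e -> P d y) ->
  exists2 e : R, 0 < e & forall y, K y -> forall d, 0 < d -> d <= e -> P d y.
Proof.
move=> /compact_near_coveringP cK HP.
have : \forall e \near (0 : R)^'+, K `<=` (fun y => forall d, 0 < d -> d <= e -> P d y).
  apply: cK => x Kx; have [e e0 xe] := HP x Kx.
  exists ([set y | forall d, 0 < d -> d <= e -> P d y], [set e' | e' <= e]) => /=.
    by split=> //; exact: nbhs_right_le.
  by move=> [y e'] /= [Py ee] d d0 de'; apply: Py => //; exact: le_trans ee.
move=> H; have [e [He e0]] := filter_ex (filterI H (nbhs_right_gt 0)).
by exists e => // y Ky; exact: He.
Qed.

(** * Smooth cutoff functions *)

Section Cutoff.
Context (R : realType) (n : nat) (M : topologicalType).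
Context (X : smooth_manifold R n M) (g : riemannian_metric X).
Implicit Types (c : chart X) (p x y z : M) (u v : 'rV[R]_n).

Lemma smooth_function_local (h : M -> R) :
  (forall x, exists (N : set M) (h' : M -> R), [/\ open N, N x,
     smooth_function X h' & forall y, N y -> h y = h' y]) -> smooth_function X h.
Proof.
move=> loc c k; apply: Ck_on_local => [|u cu]; first exact: chart_cod_open.
have [N [h' [oN Nu h'C hh']]] := loc (chart_inv c u).
exists (chart_map c @` (chart_dom c `&` N)), (h' \o chart_inv c); split.
- exact: chart_map_open.
- by exists (chart_inv c u); [split=> //; exact: chart_inv_dom|exact: chart_invK].
- by apply: Ck_on_sub (h'C c k) => _ [y [cy _] <-]; exact: chart_map_cod.
- by move=> _ [y [cy Ny] <-]; rewrite /= chart_mapK// hh'.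
Qed.

Lemma smooth_function_cst (a : R) : smooth_function X (fun=> a).
Proof. by move=> c k; exact: (Ck_on_cst k (chart_cod c) (a : R^o)). Qed.

Lemma smooth_functionZ (a : R) (h : M -> R) : smooth_function X h ->
  smooth_function X (fun x => a * h x).
Proof.
move=> hC c k; have oc : open (chart_cod c) by exact: chart_cod_open.
exact: (Ck_onM oc (Ck_on_cst k (chart_cod c) (a : R^o)) (hC c k)).
Qed.

Variables (theta : R -> R) (L : R).
Hypothesis L0 : 0 < L.
Hypothesis theta_le0 : forall t, t <= 0 -> theta t = 1.
Hypothesis theta_ge1 : forall t, 1 <= t -> theta t = 0.
Hypothesis theta01 : forall t, 0 <= theta t <= 1.
Hypothesis theta_lip : forall s t, `|theta s - theta t| <= L * `|s - t|.
Hypothesis theta_Ck : forall m k (U : set 'rV[R]_m) (h : 'rV[R]_m -> R^o), open U ->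
  Ck_on k U h -> Ck_on k U (theta \o h : 'rV[R]_m -> R^o).

(** The radius 10 leaves room for the distortion by charts, a factor 2 in each
    direction. The Lipschitz condition is expressed with balls since the distance
    may be infinite, and only at distances below the scale, which is enough to
    bound gradients. *)
Definition bump (C : R) p (e : R) (phi : M -> R) : Prop :=
  [/\ smooth_function X phi, forall y, 0 <= phi y,
      forall y, geodesic_ball g p e y -> phi y = 1,
      forall y, phi y != 0 -> geodesic_ball g p (10 * e) y &
      forall y z r, r <= e -> geodesic_ball g y r z -> `|phi y - phi z| <= C / e * r].

Lemma geodesic_ball_gt0 y (r : R) z : geodesic_ball g y r z -> 0 < r.
Proof. by move=> /geodesic_ballP[K /path_length_ge0 K0 Kr]; have := le_lt_trans K0 Kr. Qed.

(** The bump is a function of the Euclidean distance to [p] for the fixed form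
    [gram g c u0], which is comparable with the metric near [p0]. *)
Lemma exists_local_bump p0 : exists2 e0 : R, 0 < e0 &
  \forall p \near p0, forall e, 0 < e -> e <= e0 -> exists phi, bump (2 * L) p e phi.
Proof.
pose c := chart_at X p0; have cp0 : chart_dom c p0 by exact: chart_at_dom.
set u0 := chart_map c p0; have cu0 : chart_cod c u0 by exact: chart_map_cod.
have [s s0 gs] := exists_good_radius g cu0; set G := gram g c u0 in gs.
have Gs : spd G by exact: gram_spd.
(* The bump lives where [qnorm G (u - up) <= 4 * e] and its Lipschitz estimate
   looks [2 * e] further: with [up] within [s / 4] of [u0] and [e <= s / 16] all
   of this stays within the good radius [s]. *)
exists (s / 16); first exact: divr_gt0.
pose W (r : R) := chart_inv c @` [set u | qnorm G (u - u0) < r].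
have WE r y : r <= s -> W r y -> chart_dom c y /\ qnorm G (chart_map c y - u0) < r.
  move=> rs [u /= ur <-]; have [cu _] := gs u (lt_le_trans ur rs).
  by split; [exact: chart_inv_dom|rewrite chart_invK].
have oW r : r <= s -> open (W r).
  move=> rs; apply: chart_inv_open; first exact: qnorm_ball_open.
  by move=> u /= ur; have [] := gs u (lt_le_trans ur rs).
have Wmem r y : chart_dom c y -> qnorm G (chart_map c y - u0) < r -> W r y.
  by move=> cy yr; exists (chart_map c y) => //; exact: chart_mapK.
have s4 : s / 4 <= s by move: s0; lra.
have : nbhs p0 (W (s / 4)).
  apply: open_nbhs_nbhs; split; first exact: oW.
  by apply: Wmem => //; rewrite subrr qnorm0 divr_gt0.
apply: filterS => p /(WE _ _ s4)[cp ps] e e0 es.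
set up := chart_map c p in ps.
pose q y := bform G (chart_map c y - up) (chart_map c y - up).
(* Equal to 1 for norms up to [2 * e] and to 0 from [4 * e] on. *)
pose tau y := theta ((q y / e ^+ 2 - 4) / 12).
pose phi y := if `[< W s y >] then tau y else 0.
have qE y : q y = qnorm G (chart_map c y - up) ^+ 2 by rewrite sqr_qnorm.
have e20 : 0 < e ^+ 2 by exact: exprn_gt0.
have tau0 y : 4 * e <= qnorm G (chart_map c y - up) -> tau y = 0.
  move=> H; apply: theta_ge1; rewrite ler_pdivlMr// mul1r lerBrDr ler_pdivlMr//.
  have : (4 * e) ^+ 2 <= q y by rewrite qE ler_pXn2r ?nnegrE ?qnorm_ge0// mulr_ge0// ltW.
  by rewrite exprMn; lra.
have phi_neq0 y : phi y != 0 -> W s y /\ qnorm G (chart_map c y - up) < 4 * e.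
  rewrite /phi; case: asboolP => [Wy ty|]; last by rewrite eqxx.
  by split=> //; rewrite ltNge; apply: contra ty => /tau0 ->.
have near_p y : qnorm G (chart_map c y - up) < 4 * e -> qnorm G (chart_map c y - u0) < s / 2.
  move=> H; apply: le_lt_trans (qnorm_triangle _ up _ Gs) _.
  by move: ps H es; rewrite /up; lra.
(* The quadratic form is Lipschitz on the support: q y - q z factors as
   (a - b) (a + b) with a - b of order [r] and a + b of order [e]. *)
have lip y z r : phi y != 0 -> r <= e -> geodesic_ball g y r z ->
    `|phi y - phi z| <= 2 * L / e * r.
  move=> /phi_neq0[Wy yp] re yz; have r0 := geodesic_ball_gt0 yz.
  have [cy _] := WE s y (lexx s) Wy; have ys := near_p y yp.
  have ysr : qnorm G (chart_map c y - u0) + 2 * r < s by move: ys re es s0; lra.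
  have [cz dz] := ball_stays gs yz cy ysr.
  have zs : qnorm G (chart_map c z - u0) < s.
    apply: le_lt_trans (qnorm_triangle _ (chart_map c y) _ Gs) _.
    by move: dz ysr; lra.
  have Wz : W s z by exact: Wmem.
  rewrite /phi !asboolT//; apply: le_trans (theta_lip _ _) _.
  set a := qnorm G (chart_map c y - up) in yp; pose b := qnorm G (chart_map c z - up).
  have ab : `|a - b| <= 2 * r.
    apply: le_trans (ler_dist_qnorm _ _ Gs) _.
    by rewrite opprB addrA subrK qnormBC.
  have a0 : 0 <= a by exact: qnorm_ge0.
  have b0 : 0 <= b by exact: qnorm_ge0.
  have b6 : b <= 6 * e by move: ab; rewrite ler_norml => /andP[]; move: yp re; lra.
  rewrite (_ : _ - _ = (a - b) * (a + b) / (12 * e ^+ 2)); last first.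
    by rewrite !qE -/a -/b; field; rewrite gt_eqF.
  rewrite normrM (ger0_norm (_ : 0 <= (12 * e ^+ 2)^-1)); last by rewrite invr_ge0 mulr_ge0// ltW.
  rewrite normrM (ger0_norm (addr_ge0 a0 b0)).
  have H : `|a - b| * (a + b) <= 2 * r * (10 * e).
    by rewrite ler_pM ?addr_ge0//; move: yp b6; lra.
  apply: (@le_trans _ _ (L * (2 * r * (10 * e) / (12 * e ^+ 2)))).
    by apply: ler_wpM2l; [exact: ltW|]; apply: ler_wpM2r => //; rewrite invr_ge0 mulr_ge0// ltW.
  rewrite (_ : L * _ = (20 / 12) * (L / e * r)); last by field; rewrite gt_eqF.
  rewrite (_ : 2 * L / e * r = 2 * (L / e * r)); last by ring.
  have t0 : 0 <= L / e * r by rewrite mulr_ge0 ?divr_ge0// ltW.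
  by move: t0; set t := L / e * r; lra.
exists phi; split.
- pose F := chart_inv c @` [set u | qnorm G (u - up) <= 4 * e].
  have Fs u : qnorm G (u - up) <= 4 * e -> qnorm G (u - u0) < s.
    move=> H; apply: le_lt_trans (qnorm_triangle _ up _ Gs) _.
    by move: ps H es s0; rewrite /up; lra.
  have cF : closed F.
    apply: chart_inv_closed; first exact: qnorm_closed_ball_compact.
    by move=> u /= /Fs/gs[].
  have FW : F `<=` W s by move=> _ [u /= /Fs us <-]; exists u.
  move=> c' k; apply: Ck_on_local => [|u' cu']; first exact: chart_cod_open.
  have [Wu|nWu] := pselect (W s (chart_inv c' u')); last first.
    exists (chart_map c' @` (chart_dom c' `&` ~` F)), (cst (0 : R^o)); split.
    + by apply: chart_map_open; exact: closed_openC.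
    + exists (chart_inv c' u'); last exact: chart_invK.
      by split; [exact: chart_inv_dom|move=> /FW].
    + exact: Ck_on_cst.
    + move=> _ [y [c'y nFy] <-]; rewrite /= chart_mapK// /phi.
      case: asboolP => // Wy; rewrite tau0// leNgt; apply/negP => yp; apply: nFy.
      have [cy _] := WE s y (lexx s) Wy.
      by exists (chart_map c y); [exact: ltW|exact: chart_mapK].
  pose V := chart_map c' @` (chart_dom c' `&` W s).
  have oV : open V by apply: chart_map_open; exact: oW.
  pose T := chart_map c \o chart_inv c'.
  have TV : Ck_on k V T.
    apply: Ck_on_sub (@transition_smooth _ _ _ X c' c k).
    by move=> _ [y [c'y /(WE _ _ (lexx s))[cy _]] <-]; exists y.
  have TVi i : Ck_on k V (fun v => T v 0 i - up 0 i : R^o).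
    have := Ck_onD oV (Ck_on_coord i oV TV) (Ck_on_cst k V (- up 0 i : R^o)).
    exact: eq_Ck_on.
  have qV : Ck_on k V (fun v => \sum_i \sum_j (T v 0 i - up 0 i) * G i j * (T v 0 j - up 0 j) : R^o).
    apply: (@Ck_on_sum _ _ R^o) => // i; apply: (@Ck_on_sum _ _ R^o) => // j.
    apply: Ck_onM => //; apply: Ck_onM => //; exact: (Ck_on_cst k V (G i j : R^o)).
  have aV : Ck_on k V (fun v => (\sum_i \sum_j (T v 0 i - up 0 i) * G i j * (T v 0 j - up 0 j))
      * (12 * e ^+ 2)^-1 + (- 4 / 12) : R^o).
    apply: Ck_onD => //; last exact: (Ck_on_cst k V (- 4 / 12 : R^o)).
    apply: Ck_onM => //; exact: (Ck_on_cst k V ((12 * e ^+ 2)^-1 : R^o)).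
  exists V, (theta \o (fun v => (\sum_i \sum_j (T v 0 i - up 0 i) * G i j * (T v 0 j - up 0 j))
      * (12 * e ^+ 2)^-1 + (- 4 / 12))); split=> //.
  + by exists (chart_inv c' u'); [split=> //; exact: chart_inv_dom|exact: chart_invK].
  + exact: theta_Ck.
  + move=> _ [y [c'y Wy] <-]; rewrite /= chart_mapK// /phi asboolT// /tau.
    congr theta; rewrite /q bformE.
    rewrite (eq_bigr (fun i => \sum_j (chart_map c y - up) 0 i * G i j * (chart_map c y - up) 0 j)).
      by field; rewrite gt_eqF.
    by move=> i _; apply: eq_bigr => j _; rewrite /T /= chart_mapK// !mxE.
- by move=> y; rewrite /phi; case: asboolP => // _; have /andP[] := theta01 ((q y / e ^+ 2 - 4) / 12).
- move=> y py; have pse : qnorm G (chart_map c p - u0) + 2 * e < s.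
    by move: ps es s0; rewrite /up; lra.
  have [cy dy] := ball_stays gs py cp pse.
  have Wy : W s y.
    apply: Wmem => //; apply: le_lt_trans (qnorm_triangle _ up _ Gs) _.
    by move: dy pse; rewrite /up; lra.
  rewrite /phi asboolT//; apply: theta_le0.
  rewrite ler_pdivrMr// mul0r subr_le0 ler_pdivrMr// qE.
  have : qnorm G (chart_map c y - up) ^+ 2 <= (2 * e) ^+ 2.
    by rewrite ler_pXn2r ?nnegrE ?qnorm_ge0// mulr_ge0// ltW.
  by rewrite exprMn; lra.
- move=> y /phi_neq0[Wy yp]; have [cy ys] := WE s y (lexx s) Wy.
  rewrite -(chart_mapK cp) -(chart_mapK cy); apply: (ball_chart_line gs) => //.
    by move: ps s0; rewrite /up; lra.
  by move: yp e0; rewrite /up; lra.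
- move=> y z r re yz; have [y0|/lip] := eqVneq (phi y) 0; last exact.
  have [z0|z0] := eqVneq (phi z) 0; last by rewrite distrC; exact: lip z0 re (geodesic_ball_sym yz).
  rewrite y0 z0 subrr normr0 mulr_ge0 ?divr_ge0 ?mulr_ge0 ?ltW//.
  exact: geodesic_ball_gt0 yz.
Qed.

(** Composing a sum of bumps with the step function gives 1 near the covered
    region without normalizing the bumps; only the boundedly many bumps alive
    at a point contribute to the Lipschitz constant there. *)
Lemma exists_cutoff (C m : R) x (a r1 e : R) (N : nat) (p : 'I_N -> M)
    (phi : 'I_N -> M -> R) : 0 <= C -> 0 < e -> a <= r1 ->
  (forall i, bump C (p i) e (phi i)) ->
  (forall y, geodesic_ball g x r1 y -> exists i, geodesic_ball g (p i) e y) ->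
  (forall y, #|[pred i | `[< geodesic_ball g (p i) (11 * e) y >]]|%:R <= m) ->
  exists psi : M -> R, [/\ smooth_function X psi, forall y, 0 <= psi y <= 1,
    forall y, geodesic_ball g x (a - e) y -> psi y = 1,
    forall y, psi y != 0 -> geodesic_ball g x (a + 10 * e) y &
    forall y z r, r <= e -> geodesic_ball g y r z ->
      `|psi y - psi z| <= L * m * C / e * r].
Proof.
move=> C0 e0 ar1 bphi cov overlap.
pose S y := \sum_(i | `[< geodesic_ball g x a (p i) >]) phi i y.
have phi_ge0 i y : 0 <= phi i y by have [] := bphi i.
exists (fun y => 1 - theta (S y)); split.
- move=> c k; have oc : open (chart_cod c) by exact: chart_cod_open.
  have SC : Ck_on k (chart_cod c) (S \o chart_inv c : _ -> R^o).
    apply: (@eq_Ck_on _ _ R^o _ _ (fun u => \sum_(i <- enum 'I_N)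
      (if `[< geodesic_ball g x a (p i) >] then phi i (chart_inv c u) else 0))) => //.
      by move=> u _; rewrite /S /= -big_mkcond/= big_enum_cond.
    apply: (@Ck_on_sum _ _ R^o _ _ k _ (fun i u =>
      if `[< geodesic_ball g x a (p i) >] then phi i (chart_inv c u) else 0)) => // i.
    case: (`[< _ >]); last exact: (Ck_on_cst k _ (0 : R^o)).
    by have [+ _ _ _ _] := bphi i; exact.
  have TC : Ck_on k (chart_cod c) (fun u => -1 * theta (S (chart_inv c u)) : R^o).
    apply: Ck_onM => //; first exact: (Ck_on_cst k _ (-1 : R^o)).
    exact: (theta_Ck oc SC).
  apply: eq_Ck_on (Ck_onD oc (Ck_on_cst k _ (1 : R^o)) TC) => // u _ /=.
  by rewrite mulN1r.
- by move=> y; have /andP[h1 h2] := theta01 (S y); apply/andP; split; lra.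
- move=> y xy; have [i iy] : exists i, geodesic_ball g (p i) e y.
    by apply: cov; apply: geodesic_ball_le xy; move: e0 ar1; lra.
  have xi : geodesic_ball g x a (p i).
    by have := geodesic_ball_trans xy (geodesic_ball_sym iy); rewrite subrK.
  rewrite theta_ge1 ?subr0// /S (bigD1 i)/=; last exact/asboolP.
  by have [_ _ -> // _ _] := bphi i; rewrite lerDl sumr_ge0.
- move=> y Sy; have [i xi iy] : exists2 i, geodesic_ball g x a (p i) & phi i y != 0.
    apply: contrapT => H; move/eqP: Sy; apply.
    rewrite /S big1 ?theta_le0 ?subrr// => i /asboolP xi; apply/eqP/negPn/negP => iy.
    by apply: H; exists i.
  by have [_ _ _ /(_ y iy) py _] := bphi i; exact: geodesic_ball_trans xi py.
- move=> y z r re yz; have r0 := geodesic_ball_gt0 yz.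
  rewrite (_ : _ - _ = theta (S z) - theta (S y)); last by ring.
  rewrite distrC; apply: le_trans (theta_lip _ _) _.
  rewrite -!mulrA; apply: ler_wpM2l; first exact: ltW.
  pose J := [pred i | `[< geodesic_ball g (p i) (11 * e) y >]].
  have far i : i \notin J -> phi i y - phi i z = 0.
    move=> /negP iJ; have [_ _ _ supp _] := bphi i.
    have [y0|/supp iy] := eqVneq (phi i y) 0; last first.
      by case: iJ; apply/asboolP; apply: geodesic_ball_le iy; move: e0; lra.
    have [z0|/supp iz] := eqVneq (phi i z) 0; first by rewrite y0 z0 subrr.
    case: iJ; apply/asboolP.
    have := geodesic_ball_trans iz (geodesic_ball_sym yz).
    by apply: geodesic_ball_le; move: re; lra.
  rewrite /S -sumrB; apply: le_trans (ler_norm_sum _ _ _) _.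
  apply: (@le_trans _ _ (\sum_(i in J) C / e * r)); last first.
    rewrite sumr_const -mulr_natl [leRHS](_ : _ = m * (C / e * r)); last by ring.
    apply: ler_wpM2r; first by rewrite mulr_ge0 ?divr_ge0// ltW.
    exact: overlap.
  rewrite [leRHS]big_mkcond [leLHS]big_mkcond /=; apply: ler_sum => i _.
  have Cer : 0 <= C / e * r by rewrite mulr_ge0 ?divr_ge0// ltW.
  case: ifPn => [_|_]; last by case: ifP.
  case: ifPn => [_|/far ->]; last by rewrite normr0.
  by have [_ _ _ _] := bphi i; exact.
Qed.

End Cutoff.

Section Gradient.
Context (R : realType) (n : nat) (M : topologicalType).
Context (X : smooth_manifold R n M) (g : riemannian_metric X).

(** The inverse Gram matrix in the gradient cancels against the metric. *)
Lemma inner_grad (h : M -> R) x (V : tangent X x) : smooth_function X h ->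
  inner g V (grad g h x) =
  'D_(V : 'rV[R]_n) (h \o chart_inv (chart_at X x) : 'rV[R]_n -> R^o)
     (chart_map (chart_at X x) x).
Proof.
move=> hC; set c := chart_at X x; set u := chart_map c x.
have cu : chart_cod c u by apply/chart_map_cod/chart_at_dom.
have oc : open (chart_cod c) by exact: chart_cod_open.
have Gs := gram_at_spd g x.
rewrite (derive_sum_partial _ (C1_differentiable oc (hC c 1) cu)).
rewrite /inner /grad trmx_mul trmx_inv (proj1 Gs) !mulmxA mulmxK ?spd_unitmx//.
by rewrite mxE; apply: eq_bigr => i _; rewrite !mxE.
Qed.

(** The left-hand side is a directional derivative in the chart at [x]; its
    difference quotients compare points at distance at most
    [2 * `|t|], and any constant above 2 serves since balls are open. *)
Lemma lipschitz_inner_grad (h : M -> R) x (V : tangent X x) (lam rho : R) :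
  smooth_function X h -> 0 <= lam -> 0 < rho ->
  (forall y r, r <= rho -> geodesic_ball g x r y -> `|h x - h y| <= lam * r) ->
  tnorm g V <= 1 -> `|inner g V (grad g h x)| <= 3 * lam.
Proof.
move=> hC lam0 rho0 hlip V1; rewrite inner_grad//.
set c := chart_at X x; set u := chart_map c x.
have cx : chart_dom c x by exact: chart_at_dom.
have cu : chart_cod c u by exact: chart_map_cod.
have oc : open (chart_cod c) by exact: chart_cod_open.
have [s s0 gs] := exists_good_radius g cu.
have HD : derivable (h \o chart_inv c : 'rV[R]_n -> R^o) u V.
  by apply: diff_derivable; exact: (C1_differentiable oc (hC c 1) cu).
have V1' : qnorm (gram g c u) V <= 1 by [].
have cl : closed [set z : R | `|z| <= 3 * lam].
  have -> : [set z : R | `|z| <= 3 * lam] = Num.norm @^-1` [set z | z <= 3 * lam] by [].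
  by apply: closed_comp; [move=> z _; exact: norm_continuous|exact: closed_le].
have near_quot : \forall t \near (0 : R)^', [set z : R | `|z| <= 3 * lam]
    (t^-1 *: (((h \o chart_inv c : 'rV[R]_n -> R^o) \o shift u) (t *: (V : 'rV[R]_n)) -
      (h \o chart_inv c) u)); last exact: (closed_cvg _ cl near_quot _ HD).
near=> t.
have t0 : t != 0 by near: t; exact: nbhs_dnbhs_neq.
have ts : `|t| < s by near: t; exact: dnbhs0_lt.
have trho : `|t| <= rho / 3 by near: t; apply: dnbhs0_le; exact: divr_gt0.
have tpos : 0 < `|t| by rewrite normr_gt0.
rewrite /= normrM normfV ler_pdivrMl// distrC chart_mapK//.
rewrite (_ : `|t| * (3 * lam) = lam * (3 * `|t|)); last by ring.
apply: hlip; first by move: trho; lra.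
rewrite -[X in geodesic_ball g X](chart_mapK cx); apply: (ball_chart_line gs).
- by rewrite subrr qnorm0.
- by rewrite addrK qnormZ; apply: le_lt_trans ts; rewrite ler_piMr.
- rewrite addrK qnormZ; apply: (@le_lt_trans _ _ (2 * `|t|)); last by move: tpos; lra.
  by rewrite ler_pM2l// ler_piMr.
Unshelve. all: by end_near. Qed.

End Gradient.

(** * The integral estimate *)

Section CollarEstimate.
Context (R : realType) (n : nat) (M : ptopologicalType).
Context (X : smooth_manifold R n M) (g : riemannian_metric X).
Context (vol : {measure set (borel M) -> \bar R}).
Variables (K : set M) (A : forall x : M, R -> tangent X x -> R).
Variables (f : M -> R) (df : forall x : M, tangent X x).
Hypothesis hsol : weak_solution g vol (~` K) (@A) f df.
Hypothesis cK : closed K.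
Let F (x : M) : R := @A x (f x) (df x).
Let V (x : M) : tangent X x := (tnorm g (df x))^-1 *: (df x : 'rV[R]_n).

Lemma tnorm_unit_field x : tnorm g (V x) <= 1.
Proof.
rewrite /tnorm /inner -/(bform _ _ _) -/(qnorm _ _) /V qnormZ ger0_norm; last first.
  by rewrite invr_ge0; exact: qnorm_ge0.
rewrite /tnorm /inner -/(bform _ _ _) -/(qnorm _ _).
have [->|q0] := eqVneq (qnorm (gram_at g x) (df x)) 0; first by rewrite mulr0.
by rewrite mulVf.
Qed.

Lemma measurable_setC_closed : measurable (~` K : set (borel M)).
Proof. by apply: measurable_borel_open; exact: closed_openC. Qed.

(** Test the equation with [sigma * psi]. The right-hand side is at least [w] on
    [B], where [psi] is 1; the flux is bounded by the gradient of [psi], which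
    vanishes off [C] because [psi] is locally constant there. *)
Lemma collar_estimate (sigma psi : M -> R) (w lam rho : R) (B C : set M) :
  (forall x, `|sigma x| <= 1) ->
  (forall x, ~ K x -> \forall y \near x, sigma y = sigma x) ->
  0 <= w -> {ae vol, forall x : M, ~ K x -> w <= sigma x * F x} ->
  smooth_function X psi -> compactly_supported_in (~` K) psi ->
  (forall x, 0 <= psi x <= 1) -> (forall x, B x -> psi x = 1) ->
  0 <= lam -> 0 < rho ->
  (forall x y r, r <= rho -> geodesic_ball g x r y -> `|psi x - psi y| <= lam * r) ->
  (forall x y, ~ C x -> geodesic_ball g x rho y -> psi x = psi y) ->
  B `<=` ~` K -> measurable (B : set (borel M)) -> measurable (C : set (borel M)) ->
  (vol B < +oo)%E -> (vol C < +oo)%E ->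
  w * fine (vol B) <= 3 * lam * fine (vol C).
Proof.
move=> sigma1 sigmaK w0 [N [mN N0 HN]] psiC [psi_compact psi_supp] psi01 psiB lam0
  rho0 psi_lip psi_const BK mB mC Boo Coo.
pose h x := sigma x * psi x.
have oK : open (~` K) by exact: closed_openC.
have mK := measurable_setC_closed.
have hC : smooth_function X h.
  apply: smooth_function_local => x; have [Kx|Kx] := pselect (K x).
    exists (~` closure [set x | psi x != 0]), (fun=> 0); split.
    - by apply: closed_openC; exact: closed_closure.
    - by move=> /psi_supp.
    - exact: smooth_function_cst.
    - move=> y ycl; rewrite /h; have [->|y0] := eqVneq (psi y) 0; first by rewrite mulr0.
      by case: ycl; exact: subset_closure.
  have /nbhs_interior := sigmaK x Kx; rewrite nbhsE => -[U [oU Ux] Us].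
  exists U, (fun y => sigma x * psi y); split=> //; first exact: smooth_functionZ.
  by move=> y /Us/interior_subset /= sy; rewrite /h sy.
have hsupp : [set x | h x != 0] `<=` [set x | psi x != 0].
  by move=> x /=; apply: contra => /eqP px; rewrite /h px mulr0.
have htest : test_function X (~` K) h.
  split=> //; split; last exact: subset_trans (closureS hsupp) psi_supp.
  apply: subclosed_compact psi_compact (closureS hsupp); exact: closed_closure.
have [_ /(_ h htest)[Fh_int weak]] := hsol.
pose I x := inner g (V x) (grad g h x).
have grad_le x : ~ K x -> `|I x| <= 3 * lam * \1_C x.
  move=> Kx; have [d d0 dsig] := nbhs_geodesic_ball_sub g (sigmaK x Kx).
  have e0 : 0 < Num.min rho d by rewrite lt_min rho0.
  have dist y r : r <= Num.min rho d -> geodesic_ball g x r y ->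
      `|h x - h y| <= `|psi x - psi y|.
    rewrite le_min => /andP[rr rd] xy; rewrite /h (dsig y (geodesic_ball_le rd xy)).
    by rewrite -mulrBr normrM ler_piMl.
  have [Cx|Cx] := pselect (C x).
    rewrite indicE mem_set// mulr1.
    apply: (lipschitz_inner_grad hC lam0 e0 _ (tnorm_unit_field x)) => y r re xy.
    apply: le_trans (dist y r re xy) _; apply: psi_lip => //.
    by move: re; rewrite le_min => /andP[].
  rewrite indicE memNset// mulr0 -(mulr0 3).
  apply: (lipschitz_inner_grad hC (lexx 0) e0 _ (tnorm_unit_field x)) => y r re xy.
  apply: le_trans (dist y r re xy) _; rewrite mul0r (psi_const x y) ?subrr ?normr0//.
  by apply: geodesic_ball_le xy; move: re; rewrite le_min => /andP[].
have Cint : (\int[vol]_(x in ~` K) (3 * lam * \1_C x)%:E <= (3 * lam * fine (vol C))%:E)%E.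
  under eq_integral do rewrite EFinM.
  rewrite ge0_integralZl_EFin ?mulr_ge0//; last by apply/measurable_EFinP.
  rewrite integral_indic// [leRHS]EFinM fineK ?ge0_fin_numE//.
  apply: lee_wpmul2l; first by rewrite lee_fin mulr_ge0.
  by apply: le_measure; rewrite ?inE//; exact: measurableI.
have Ineg : (\int[vol]_(x in ~` K) ((EFin \o I)^\- x) <= (3 * lam * fine (vol C))%:E)%E.
  apply: le_trans Cint; apply: ge0_le_integral_any => // x Kx.
  rewrite funenegE /= ge_max !lee_fin !mulr_ge0// andbT.
  by apply: le_trans (grad_le x Kx); rewrite -normrN ler_norm.
have Ipos : (\int[vol]_(x in ~` K) ((EFin \o I)^\+ x) <= (3 * lam * fine (vol C))%:E)%E.
  apply: le_trans Cint; apply: ge0_le_integral_any => // x Kx.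
  rewrite funeposE /= ge_max !lee_fin !mulr_ge0// andbT.
  by apply: le_trans (grad_le x Kx); rewrite ler_norm.
(* The flux need not be measurable; its positive and negative parts are bounded
   separately by the integral of a constant over the collar. *)
have upper : (\int[vol]_(x in ~` K) (F x * h x)%:E <= (3 * lam * fine (vol C))%:E)%E.
  have -> : (\int[vol]_(x in ~` K) (F x * h x)%:E)%E =
      (- \int[vol]_(x in ~` K) (I x)%:E)%E by rewrite weak oppeK.
  rewrite integralE.
  have P0 : (0 <= \int[vol]_(x in ~` K) ((EFin \o I)^\+ x))%E by exact: integral_ge0.
  have N0' : (0 <= \int[vol]_(x in ~` K) ((EFin \o I)^\- x))%E by exact: integral_ge0.
  rewrite fin_num_oppeB; last first.
    by rewrite ge0_fin_numE//; apply: le_lt_trans Ineg _; rewrite ltry.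
  by apply: le_trans Ineg; rewrite addeC geeDl// oppe_le0.
have lower : ((w * fine (vol B))%:E <= \int[vol]_(x in ~` K) (F x * h x)%:E)%E.
  rewrite (negligible_integral mN mK Fh_int N0).
  have Bint : (\int[vol]_(x in ~` K `\` N) (w * \1_B x)%:E)%E = (w * fine (vol B))%:E.
    under eq_integral do rewrite EFinM.
    have mKN : measurable (~` K `\` N : set (borel M)) by exact: measurableD.
    rewrite ge0_integralZl_EFin//; last by apply/measurable_EFinP.
    rewrite integral_indic// EFinM fineK ?ge0_fin_numE//; congr (_ * _)%E.
    have BN0 : vol ((B : set (borel M)) `&` N) = 0%E.
      apply/eqP; rewrite -measure_le0 -N0; apply: le_measure; rewrite ?inE//.
      exact: measurableI.
    have E := measureD mB mN Boo; rewrite setIDA (setIidl BK).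
    by apply: (etrans E); rewrite -[RHS]sube0; congr (_ - _)%E.
  rewrite -Bint; apply: ge0_le_integral_any => x [Kx Nx]; rewrite lee_fin.
    by rewrite mulr_ge0.
  have wF : w <= sigma x * F x by apply: contrapT => nw; apply: Nx; apply: HN => /(_ Kx).
  have /andP[p0 p1] := psi01 x.
  rewrite /h mulrA [F x * _]mulrC; apply: (@le_trans _ _ (w * psi x)).
    apply: ler_wpM2l => //; rewrite indicE.
    have [Bx|Bx] := pselect (B x); first by rewrite mem_set// psiB.
    by rewrite memNset.
  exact: ler_wpM2r.
by rewrite -lee_fin; exact: le_trans lower upper.
Qed.

End CollarEstimate.

(** * Letting the radius tend to infinity *)

Section RadiusBound.
Context (R : realType) (n : nat) (M : ptopologicalType).
Context (X : smooth_manifold R n M) (g : riemannian_metric X).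
Context (leb : {measure set (borel 'rV[R]_n) -> \bar R}).
Context (vol : {measure set (borel M) -> \bar R}).
Hypotheses (hleb : is_lebesgue leb) (hvol : is_riemannian_volume g leb vol).
Hypothesis hcomplete : complete_manifold g.
Variable D : R.
Hypothesis D0 : 0 < D.
Hypothesis doubling : forall (r : R) (x : M), 0 < r ->
  (vol (geodesic_ball g x (2 * r)) <= D%:E * vol (geodesic_ball g x r))%E.

Lemma closure_geodesic_ball x (r s : R) : r < s ->
  closure (geodesic_ball g x r) `<=` geodesic_ball g x s.
Proof.
move=> rs y /(_ _ (nbhs_geodesic_ball g y (_ : 0 < s - r))); rewrite subr_gt0 => /(_ rs)[z [xz yz]].
have := geodesic_ball_trans xz (geodesic_ball_sym yz).
by rewrite addrC subrK.
Qed.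

(** At most [D ^+ 6] bumps are alive at a point, by packing at radius [11 * e]:
    23 <= 2 ^ 6 / 2. *)
Lemma overlap_bound (e : R) (N : nat) (p : 'I_N -> M) y : 0 < e ->
  (forall i j, i != j -> ~ geodesic_ball g (p i) e (p j)) ->
  #|[pred i | `[< geodesic_ball g (p i) (11 * e) y >]]|%:R <= D ^+ 6.
Proof.
move=> e0 psep; set J := [pred i | _].
apply: (@packing _ _ _ _ g _ _ hleb hvol D D0 doubling y (11 * e) e 6 #|J|
  (fun i => p (enum_val i))) => //.
- by rewrite mulr_gt0.
- by move: e0; lra.
- move=> i; have := enum_valP i; rewrite unfold_in => /asboolP iy.
  exact: geodesic_ball_sym.
- by move=> i j ij; apply: psep; rewrite (inj_eq enum_val_inj).
Qed.

Lemma vol_collar x (r s : R) : r <= s ->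
  fine (vol (geodesic_ball g x s `\` geodesic_ball g x r)) =
  fine (vol (geodesic_ball g x s)) - fine (vol (geodesic_ball g x r)).
Proof.
move=> rs; have E := measureD (measurable_ball g x s) (measurable_ball g x r)
  (vol_ball_fin hleb hvol D0 doubling x s).
rewrite -fineB ?(vol_ball_fin_num hleb hvol D0 doubling)//; congr fine.
apply: (etrans E); congr (_ - vol _)%E.
by rewrite setIC; apply: setIidl; exact: geodesic_ball_le.
Qed.

Variables (theta : R -> R) (L : R).
Hypothesis L0 : 0 < L.
Hypothesis theta_le0 : forall t, t <= 0 -> theta t = 1.
Hypothesis theta_ge1 : forall t, 1 <= t -> theta t = 0.
Hypothesis theta01 : forall t, 0 <= theta t <= 1.
Hypothesis theta_lip : forall s t, `|theta s - theta t| <= L * `|s - t|.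
Hypothesis theta_Ck : forall m k (U : set 'rV[R]_m) (h : 'rV[R]_m -> R^o), open U ->
  Ck_on k U h -> Ck_on k U (theta \o h : 'rV[R]_m -> R^o).

Variables (K : set M) (A : forall x : M, R -> tangent X x -> R).
Variables (f : M -> R) (df : forall x : M, tangent X x).
Hypothesis hsol : weak_solution g vol (~` K) (@A) f df.
Hypothesis ncM : ~ compact [set: M].
Hypothesis cK : compact K.
Variables (sigma : M -> R) (w : R).
Hypothesis sigma1 : forall x, `|sigma x| <= 1.
Hypothesis sigmaK : forall x, ~ K x -> \forall y \near x, sigma y = sigma x.
Hypothesis w0 : 0 <= w.
Hypothesis w_le : {ae vol, forall x : M, ~ K x -> w <= sigma x * @A x (f x) (df x)}.

(** The annulus between the radii [r] and [2 * r] is cut into collars of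
    width comparable to the scale of the bumps; summing the estimates over the collars
    replaces that scale by [r]. *)
Lemma radius_bound (r : R) : 0 < r -> w * r <= 13 * (3 * (L * D ^+ 6 * (2 * L)) * D).
Proof.
move=> r0; have r20 : 0 < 2 * r by exact: mulr_gt0.
have [x xK] := exists_ball_away hleb hvol D0 doubling hcomplete (2 * r) ncM cK.
have closedK : closed K by apply: compact_closed => //; exact: manifold_hausdorff X.
have properB (B : set M) (s : R) : closed B -> B `<=` geodesic_ball g x s -> compact B.
  exact: (bounded_closed_compact_set hleb hvol D0 doubling hcomplete).
have clB : closure (geodesic_ball g x (2 * r)) `<=` geodesic_ball g x (2 * r + 1).
  by apply: closure_geodesic_ball; rewrite ltrDl.
have cptB := properB _ _ (@closed_closure _ _) clB.
have [e0 e00 bumps] := compact_uniform_scale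
  (P := fun d y => exists phi, bump g (2 * L) y d phi) cptB
  (fun p0 _ => exists_local_bump g L0 theta_le0 theta_ge1 theta01 theta_lip theta_Ck p0).
(* A scale dividing the annulus into exactly [m.+1] collars of width
   [13 * e]. *)
have [m me] : exists m : nat, r / (13 * m.+1%:R) <= e0.
  have h : 0 <= r / (13 * e0) by rewrite divr_ge0 ?mulr_ge0 ?ltW.
  have := ltW (archi_boundP h); set b := Num.bound _; rewrite ler_pdivrMr ?mulr_gt0// => H.
  exists b; rewrite ler_pdivrMr ?mulr_gt0 ?ltr0n//; apply: le_trans H _.
  rewrite (_ : e0 * (13 * b.+1%:R) = b.+1%:R * (13 * e0)); last by ring.
  by rewrite ler_pM2r ?mulr_gt0// ler_nat leqnSn.
set e := r / (13 * m.+1%:R) in me; have e_gt0 : 0 < e by rewrite divr_gt0 ?mulr_gt0 ?ltr0n.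
have eE : 13 * e * m.+1%:R = r by rewrite /e; field; rewrite nat1r pnatr_eq0.
have idB : geodesic_ball g x (2 * r) `<=` geodesic_ball g x (2 * r) by [].
have [N [p [pP psep pcov]]] := exists_net hleb hvol D0 doubling r20 e_gt0 idB.
have bump_p i : exists phi, bump g (2 * L) (p i) e phi.
  by apply: bumps => //; apply: subset_closure; exact: pP.
have [phi phiP] := choice bump_p.
pose lam := L * D ^+ 6 * (2 * L) / e.
have lam0 : 0 <= lam by rewrite divr_ge0 ?mulr_ge0 ?exprn_ge0 ?ltW.
pose rad (k : nat) := r + 13 * e * k%:R; pose v k := fine (vol (geodesic_ball g x (rad k))).
have rad0 : rad 0 = r by rewrite /rad mulr0 addr0.
have radm : rad m.+1 = 2 * r by rewrite /rad eE; ring.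
have radS k : rad k.+1 = rad k + 13 * e by rewrite /rad -natr1; ring.
have rad_le j k : (j <= k)%N -> rad j <= rad k.
  by move=> jk; rewrite lerD2l; apply: ler_wpM2l; rewrite ?ler_nat// mulr_ge0// ltW.
have ball_disj s : s <= 2 * r -> geodesic_ball g x s `<=` ~` K.
  by move=> s2r y xy Ky; apply: (xK y Ky); exact: geodesic_ball_le xy.
have step k : (k < m.+1)%N -> w * v 0 <= 3 * lam * (v k.+1 - v k).
  move=> km; have rk2 : rad k.+1 <= 2 * r by rewrite -radm rad_le.
  have rk : r <= rad k by rewrite -rad0 rad_le.
  (* The cutoff is 1 on the ball of radius [a - e] and 0 off the ball of radius
     [a + 10 * e]; one more [e] on each side makes it constant near every point
     off the collar, whence the width 13. *)
  pose a := rad k + 2 * e.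
  have a2r : a <= 2 * r by move: rk2 e_gt0; rewrite radS /a; lra.
  have L20 : 0 <= 2 * L by rewrite mulr_ge0 ?ltW.
  have [psi [psiC psi01 psi_core psi_supp psi_lip]] :=
    exists_cutoff L0 theta_le0 theta_ge1 theta01 theta_lip theta_Ck L20 e_gt0 a2r phiP pcov
      (fun y => overlap_bound y e_gt0 psep).
  have supp_sub : closure [set y | psi y != 0] `<=` geodesic_ball g x (rad k.+1).
    apply: subset_trans (closureS psi_supp) _; apply: closure_geodesic_ball.
    by move: e_gt0; rewrite radS /a; lra.
  have supp_cpt : compactly_supported_in (~` K) psi.
    split; first exact: properB (@closed_closure _ _) supp_sub.
    exact: subset_trans supp_sub (ball_disj _ rk2).
  rewrite -(vol_collar x (rad_le k k.+1 (leqnSn k))).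
  apply: (collar_estimate hsol closedK sigma1 sigmaK w0 w_le psiC supp_cpt psi01
     (rho := e)) => //.
  - move=> y; rewrite rad0 => xy; apply: psi_core; apply: geodesic_ball_le xy.
    by move: rk e_gt0; rewrite /a; lra.
  - move=> y z nC yz; have [yin|yout] := pselect (geodesic_ball g x (rad k) y).
      rewrite !psi_core//; first by have := geodesic_ball_trans yin yz; apply: geodesic_ball_le;
        move: e_gt0; rewrite /a; lra.
      by apply: geodesic_ball_le yin; move: e_gt0; rewrite /a; lra.
    have yout' : ~ geodesic_ball g x (rad k.+1) y by move=> yin; apply: nC.
    have -> : psi y = 0.
      apply/eqP/negPn/negP => /psi_supp xy; apply: yout'; apply: geodesic_ball_le xy.
      by move: e_gt0; rewrite radS /a; lra.
    apply/esym/eqP/negPn/negP => /psi_supp xz; apply: yout'.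
    have := geodesic_ball_trans xz (geodesic_ball_sym yz); apply: geodesic_ball_le.
    by move: e_gt0; rewrite radS /a; lra.
  - by apply: ball_disj; rewrite rad0; move: r0; lra.
  - exact: measurable_ball.
  - by apply: measurableD; exact: measurable_ball.
  - exact: (vol_ball_fin hleb hvol D0 doubling).
  - apply: le_lt_trans (vol_ball_fin hleb hvol D0 doubling x (rad k.+1)).
    apply: le_measure; rewrite ?inE; [|exact: measurable_ball|exact: subDsetl].
    by apply: measurableD; exact: measurable_ball.
have sum_steps j : (j <= m.+1)%N -> j%:R * (w * v 0) <= 3 * lam * (v j - v 0).
  elim: j => [_|j IHj jm]; first by rewrite mul0r subrr mulr0.
  have := IHj (ltnW jm); have := step j jm.
  by rewrite -[j.+1%:R]natr1 => h1 h2; rewrite mulrDl mul1r; lra.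
have v0 : 0 < v 0%N.
  apply: fine_gt0; rewrite rad0 (vol_ball_gt0 hleb hvol)//.
  exact: (vol_ball_fin hleb hvol D0 doubling).
have vm : v m.+1 <= D * v 0%N.
  rewrite -lee_fin EFinM /v !fineK ?(vol_ball_fin_num hleb hvol D0 doubling)//.
  by rewrite radm rad0; exact: doubling.
have H : m.+1%:R * (w * v 0%N) <= 3 * lam * (D * v 0%N).
  apply: le_trans (sum_steps m.+1 (leqnn _)) _; apply: ler_wpM2l; first by rewrite mulr_ge0.
  by move: vm v0; lra.
have {}H : m.+1%:R * w <= 3 * lam * D.
  by rewrite -(ler_pM2r v0); move: H; rewrite !mulrA.
have : m.+1%:R * w * (13 * e) <= 3 * lam * D * (13 * e).
  by apply: ler_wpM2r => //; rewrite mulr_ge0 ?ltW.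
rewrite (_ : m.+1%:R * w * (13 * e) = w * (13 * e * m.+1%:R)); last by ring.
rewrite eE => /le_trans; apply; rewrite le_eqVlt; apply/orP; left; apply/eqP.
by rewrite /lam; field; rewrite gt_eqF.
Qed.

End RadiusBound.

(** On the open complement of [K] a continuous function bounded below in
    absolute value almost everywhere is bounded below everywhere, so its sign
    is locally constant. *)
Lemma sgr_locally_constant (R : realType) (n : nat) (M : ptopologicalType)
    (X : smooth_manifold R n M) (g : riemannian_metric X)
    (leb : {measure set (borel 'rV[R]_n) -> \bar R})
    (vol : {measure set (borel M) -> \bar R})
    (K : set M) (F : M -> R) (w : R) :
  is_lebesgue leb -> is_riemannian_volume g leb vol -> closed K ->
  continuous (F : M -> R^o) -> 0 < w ->
  {ae vol, forall x : M, ~ K x -> w <= `|F x|} ->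
  forall x, ~ K x -> \forall y \near x, Num.sg (F y) = Num.sg (F x).
Proof.
move=> hleb hvol cK Fc w0 [N [mN N0 HN]] x Kx.
have Fx : w <= `|F x|.
  rewrite leNgt; apply/negP => Fxw.
  pose U := (~` K) `&` [set y | `|F y| < w].
  have oU : open U.
    apply: openI; first exact: closed_openC.
    have -> : [set y | `|F y| < w] = (fun y => `|F y|) @^-1` [set z | z < w] by [].
    apply: open_comp; last exact: open_lt.
    by move=> y _; exact: (continuous_comp (Fc y) (@norm_continuous _ _ _)).
  have : (0 < vol U)%E by exact: (vol_open_gt0 hleb hvol oU (conj Kx Fxw)).
  have : (vol U <= vol N)%E.
    apply: le_measure; rewrite ?inE//; first exact: measurable_borel_open.
    by move=> y [Ky Fyw]; apply: HN => /(_ Ky); rewrite leNgt Fyw.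
  by rewrite N0 => /le_lt_trans H /H; rewrite ltxx.
have Fx0 : F x != 0 by rewrite -normr_gt0; exact: lt_le_trans Fx.
have [Fpos|Fneg|F0] := ltgtP 0 (F x).
- have : \forall y \near x, 0 < F y by exact: (cvgr_gt _ (Fc x)).
  by apply: filterS => y Fy; rewrite !gtr0_sg.
- have : \forall y \near x, F y < 0 by exact: (cvgr_lt _ (Fc x)).
  by apply: filterS => y Fy; rewrite !ltr0_sg.
- by rewrite F0 eqxx in Fx0.
Qed.

Lemma sub_ae d (T : measurableType d) (R : realType) (mu : {measure set T -> \bar R})
    (P Q : T -> Prop) : (forall x, P x -> Q x) ->
  {ae mu, forall x, P x} -> {ae mu, forall x, Q x}.
Proof. by move=> PQ [N [mN N0 HN]]; exists N; split=> // x nQ; apply: HN => /PQ. Qed.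

Theorem theorem5p2 (R : realType) (n : nat) (M : ptopologicalType)
    (X : smooth_manifold R n M) (g : riemannian_metric X)
    (leb : {measure set (borel 'rV[R]_n) -> \bar R})
    (vol : {measure set (borel M) -> \bar R})
    (hleb : is_lebesgue leb)
    (hvol : is_riemannian_volume g leb vol)
    (hcomplete : complete_manifold g)
    (hnoncompact : ~ compact [set: M])
    (hdoubling : global_doubling g vol)
    (K : set M) (hK : compact K)
    (A : forall x : M, R -> tangent X x -> R)
    (f : M -> R) (df : forall x : M, tangent X x)
    (hf : W11loc_with_gradient g leb f df)
    (hsol : weak_solution g vol (~` K) A f df)
    (hA : continuous (fun x => A x (f x) (df x) : R^o) \/
          (forall x, 0 <= A x (f x) (df x)) \/
          (forall x, A x (f x) (df x) <= 0)) :
  ess_inf_on vol (~` K) (fun x => `|A x (f x) (df x)|%:E) = 0%E.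
Proof.
have closedK : closed K by apply: compact_closed => //; exact: manifold_hausdorff X.
have [D [D0 doubling]] := hdoubling.
have doubling' (r : R) (x : M) : 0 < r ->
    (vol (geodesic_ball g x (2 * r)) <= D%:E * vol (geodesic_ball g x r))%E.
  by move=> r0; exact: doubling.
have [theta [L L0 [theta_le0 theta_ge1 theta01 theta_lip theta_Ck]]] := exists_smooth_step R.
pose F x := A x (f x) (df x).
apply/eqP; rewrite eq_le; apply/andP; split; last first.
  by apply: ereal_sup_ubound; apply: aeW => x _; rewrite lee_fin.
apply: ge_ereal_sup => y /= hy; rewrite leNgt; apply/negP => y0.
have [w w0 hw] : exists2 w : R, 0 < w & {ae vol, forall x : M, ~ K x -> w <= `|F x|}.
  case: y y0 hy => [w|_|//] => [w0|] hy.
    exists w; first by rewrite -lte_fin.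
    by apply: sub_ae hy => x H /H; rewrite lee_fin.
  by exists 1 => //; apply: sub_ae hy => x H /H.
have [sigma [sigma1 sigmaK sigmaF]] : exists sigma : M -> R, [/\ forall x, `|sigma x| <= 1,
    forall x, ~ K x -> \forall y \near x, sigma y = sigma x &
    forall x, sigma x * F x = `|F x|].
  case: hA => [Ac|[A0|A0]].
  - exists (fun x => Num.sg (F x)); split=> [x||x].
    + by rewrite normr_sg lern1; case: (_ != _).
    + exact: (sgr_locally_constant hleb hvol closedK Ac w0 hw).
    + by rewrite -normrEsg.
  - exists (fun=> 1); split=> [x|x _|x]; first by rewrite normr1.
      exact: filterE.
    by rewrite mul1r ger0_norm//; exact: A0.
  - exists (fun=> -1); split=> [x|x _|x]; first by rewrite normrN1.
      exact: filterE.
    by rewrite mulN1r ler0_norm//; exact: A0.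
have hw' : {ae vol, forall x : M, ~ K x -> w <= sigma x * A x (f x) (df x)}.
  by apply: sub_ae hw => x H /H; rewrite -sigmaF.
have bound (r : R) : 0 < r -> w * r <= 13 * (3 * (L * D ^+ 6 * (2 * L)) * D).
  exact: (radius_bound hleb hvol hcomplete D0 doubling' L0 theta_le0 theta_ge1 theta01
    theta_lip theta_Ck hsol hnoncompact hK sigma1 sigmaK (ltW w0) hw').
set c := 13 * _ in bound.
have c0 : 0 < c by rewrite !mulr_gt0 ?exprn_gt0.
have := bound (2 * c / w); rewrite divr_gt0 ?mulr_gt0// => /(_ isT).
rewrite mulrC divfK ?gt_eqF// leNgt => /negP; apply.
by move: c0; lra.
Qed.
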